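(* Let $1<p\le 2$, $\nu<1$ and $q=p/(p-1)$. The operator $$(Ff)(\tau)=\int_0^\infty \Psi_\tau(x)\, f(x)\,dx,\qquad F:L_{\nu,p}(\mathbb{R}_+)\to L_q(\mathbb{R}),$$ is compact.
   Context: $J_\mu$ is the Bessel function of the first kind and $K_\mu$ the modified Bessel function of the second kind (Macdonald function). For $x>0$ and $\tau\in\mathbb{R}\setminus\{0\}$ the kernel is $$\Psi_\tau(x)=\frac{K_{i\tau}(2\sqrt{2x})\,\mathrm{Im}\left[J_{i\tau}(2\sqrt{2x})\right]}{\sinh(\pi\tau/2)}.$$ For $\nu\in\mathbb{R}$ and $1\le p<\infty$, $L_{\nu,p}(\mathbb{R}_+)$ is the space of measurable functions $f$ on $\mathbb{R}_+=(0,\infty)$ with norm $\|f\|_{\nu,p}=\left(\int_0^\infty x^{\nu p-1}|f(x)|^p dx\right)^{1/p}<\infty$. *)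

(* Defs.v *)
From HB Require Import structures.
From mathcomp Require Export all_boot all_order all_algebra.
From mathcomp Require Export all_classical all_reals all_analysis.
From mathcomp Require Export complex.

Set Implicit Arguments.
Unset Strict Implicit.
Unset Printing Implicit Defensive.

Import Order.TTheory GRing.Theory Num.Theory.
Import numFieldNormedType.Exports.

Local Open Scope classical_set_scope.
Local Open Scope ring_scope.
Local Open Scope complex_scope.

Section ComplexAnalysis.
Context {R : realType}.
Implicit Types (z : R[i]) (D : set R) (f : R -> R[i]).

Definition cexp z : R[i] :=
  (expR (complex.Re z))%:C * (cos (complex.Im z) +i* sin (complex.Im z)).

(* t ^ z, meant for t > 0. *)
Definition cpow (t : R) z : R[i] := cexp ((ln t)%:C * z).

Definition ccosh z : R[i] := (cexp z + cexp (- z)) / 2%:R.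

Definition sinh (x : R) : R := (expR x - expR (- x)) / 2%:R.
Definition cosh (x : R) : R := (expR x + expR (- x)) / 2%:R.

(* Real and imaginary parts are used for limits and integrals, as R[i] carries
   neither a topology nor a sigma-algebra in the libraries. *)
Definition climn (u : nat -> R[i]) : R[i] :=
  limn (fun n => complex.Re (u n)) +i* limn (fun n => complex.Im (u n)).

Definition cmeasurable D f : Prop :=
  measurable_fun D (fun x => complex.Re (f x)) /\
  measurable_fun D (fun x => complex.Im (f x)).

Definition cintegrable D f : Prop :=
  (@lebesgue_measure R).-integrable D (fun x => (complex.Re (f x))%:E) /\
  (@lebesgue_measure R).-integrable D (fun x => (complex.Im (f x))%:E).

Definition cintegral D f : R[i] :=
  (\int[@lebesgue_measure R]_(x in D) complex.Re (f x))%R +i*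
  (\int[@lebesgue_measure R]_(x in D) complex.Im (f x))%R.

End ComplexAnalysis.

Section Bessel.
Context {R : realType}.
Implicit Types (z mu : R[i]) (x tau : R).

(* The entire function 1 / Gamma, as Gauss's limit
   1 / Gamma(z) = lim_n z (z + 1) ... (z + n) / (n! n^z). *)
Definition rGamma z : R[i] :=
  climn (fun n : nat =>
    (\prod_(0 <= k < n.+1) (z + k%:R)) / ((n`!)%:R * cpow n%:R z)).

(* J_mu(x) for x > 0, by its defining series
   sum_k (-1)^k / (k! Gamma(mu + k + 1)) (x / 2)^(mu + 2 k). *)
Definition besselJ mu x : R[i] :=
  climn (series (fun k : nat =>
    (-1) ^+ k / (k`!)%:R * rGamma (mu + k%:R + 1)
      * cpow (x / 2%:R) (mu + (2 * k)%:R))).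

(* The Macdonald function K_mu(x), for x > 0 and any complex order mu, as
   int_0^oo exp(- x cosh u) cosh(mu u) du. *)
Definition besselK mu x : R[i] :=
  cintegral `]0, +oo[
    (fun u : R => (expR (- x * cosh u))%:C * ccosh (mu * u%:C)).

Definition Psi tau x : R[i] :=
  let y := 2%:R * Num.sqrt (2%:R * x) in
  besselK (0 +i* tau) y * (complex.Im (besselJ (0 +i* tau) y))%:C
    / (sinh (pi * tau / 2%:R))%:C.

Definition indexF (f : R -> R[i]) (tau : R) : R[i] :=
  cintegral `]0, +oo[ (fun x => Psi tau x * f x).

End Bessel.

Section Spaces.
Context {R : realType}.
Implicit Types (f g : R -> R[i]) (nu p q : R).

(* The integral only sees f on (0, oo), so elements of L_(nu,p) are functions
   on R whose values outside (0, oo) are irrelevant. *)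
Definition wnorm nu p f : \bar R :=
  ((\int[@lebesgue_measure R]_(x in `]0%R, +oo[)
      (x `^ (nu * p - 1) * Normc.normc (f x) `^ p)%:E) `^ p^-1)%E.

Definition wLp nu p : set (R -> R[i]) :=
  [set f | cmeasurable `]0, +oo[ f /\ (wnorm nu p f < +oo)%E].

Definition Lqnorm q f : \bar R :=
  'N[@lebesgue_measure R]_(q%:E)[(fun t => (Normc.normc (f t))%:E)]%E.

Definition Lq q : set (R -> R[i]) :=
  [set f | cmeasurable setT f /\ (Lqnorm q f < +oo)%E].

(* X and Y are spaces of functions, not of classes modulo null sets: nX and nY
   are seminorms, and two functions represent the same element when the
   seminorm of their difference is 0. *)
Definition compact_operator
    (X : set (R -> R[i])) (nX : (R -> R[i]) -> \bar R)
    (Y : set (R -> R[i])) (nY : (R -> R[i]) -> \bar R)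
    (F : (R -> R[i]) -> R -> R[i]) : Prop :=
  [/\ forall f, X f -> Y (F f),
      forall (a : R[i]) f g, X f -> X g ->
        nY (fun t => F (fun x => a * f x + g x) t - (a * F f t + F g t)) = 0%E
    & forall f_ : nat -> R -> R[i],
        (forall n, X (f_ n)) ->
        (exists M : R, forall n, (nX (f_ n) <= M%:E)%E) ->
        exists (phi : nat -> nat) (g : R -> R[i]),
          [/\ {homo phi : m n / (m < n)%N}, Y g &
              (fun n => nY (fun t => F (f_ (phi n)) t - g t)) @ \oo --> 0%E]].

End Spaces.

(* Main.v *)
(* Everything follows from the bound |Psi_t(x)| <= C x^(- m) / (1 + |t|), for every
   m > 0 with C independent of t and x.  With y = 2 sqrt (2 x) = 2 e^u, the function
   w(u) = Gamma(1 + it) J_(it)(2 e^u) solves w'' = - (4 e^(2 u) + t^2) w, so the energy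
   w^2 + w'^2 / (4 e^(2 u) + t^2) decreases; together with the ascending series for
   u <= 0 and |1 / Gamma(1 + it)| <= e^(pi |t| / 2), this gives
   |Im J_(it)(y)| <= C min(1, |t|) e^(pi |t| / 2) (1 + max(0, - u)), which sinh(pi t / 2)
   absorbs.  Moreover K_(it)(y) decays faster than any power of y, and one integration
   by parts in its integral gains the factor 1 / |t|.
   By Young's inequality the images of a bounded sequence are then dominated by
   C / (1 + |t|), which lies in L_q, and they are equicontinuous at every t <> 0, by
   continuity of Psi in t and dominated convergence.  A subsequence thus converges
   pointwise, hence in L_q. *)

Require Import Defs.
From mathcomp Require Import measurable_realfun ring lra.
Set Implicit Arguments.
Unset Strict Implicit.
Unset Printing Implicit Defensive.
Import Order.TTheory GRing.Theory Num.Theory.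
Import numFieldNormedType.Exports.
Local Open Scope classical_set_scope.
Local Open Scope ring_scope.

(** The difficulty is uniformity in t at both ends. At t = 0 the denominator sinh (pi t / 2)
    vanishes, and so does Im J_(it), because J_0 is real. A factor min(1, |t|) is therefore carried
    through every estimate: the coefficients of the ascending series have imaginary part O(|t|), and
    so does the argument of 1 / Gamma(1 + it). The equation for w has real coefficients, so Im w has
    its own energy, which keeps this factor. For large |t| the initial velocity of w is of size |t|;
    the term t^2 in the weight of the energy absorbs it. The modulus and argument of 1 / Gamma(1 +
    it) are both read off Gauss's product, factor by factor. The freedom in m is used twice: a small
    exponent for x <= 1 and a large one for x >= 1 make |Psi_t(x)|^q x^((1 - nu) q - 1) integrable
    on the half-line, and this is where nu < 1 enters. Since Psi is real, the operator acts
    separately on real and imaginary parts, and all the analysis is done on real functions. Order t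
    = 0 is exceptional, as continuity in t is only established for t != 0; it is handled as a single
    point, both for measurability and for the extraction. *)

(** * Series dominated by a convergent series *)

Section Series.
Context {R : realType}.
Implicit Types (u M : nat -> R).

Lemma normed_le_cvg u M : (forall n, `|u n| <= M n) -> cvgn (series M) ->
  cvgn (series u).
Proof.
move=> uM cM; apply: normed_cvg.
by apply: series_le_cvg cM => //= n; exact: le_trans (uM n).
Qed.

Lemma series_norm_le u M n : (forall n, `|u n| <= M n) ->
  `|series u n| <= series M n.
Proof.
move=> uM; rewrite /series /=; apply: (le_trans (ler_norm_sum _ _ _)).
exact: ler_sum.
Qed.

Lemma lim_norm_le u M : (forall n, `|u n| <= M n) -> cvgn (series M) ->
  `|limn (series u)| <= limn (series M).
Proof.
move=> uM cM; have cu := normed_le_cvg uM cM.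
rewrite -lim_norm//; apply: ler_lim => //; first exact: is_cvg_norm.
by apply: nearW => n; exact: series_norm_le.
Qed.

Lemma tail_norm_le u M N : (forall n, `|u n| <= M n) -> cvgn (series M) ->
  `|limn (series u) - series u N| <= limn (series M) - series M N.
Proof.
move=> uM cM; have cu := normed_le_cvg uM cM.
have cuN : (series u n - series u N) @[n --> \oo] --> limn (series u) - series u N.
  by apply: cvgB => //; exact: cvg_cst.
have cMN : (series M n - series M N) @[n --> \oo] --> limn (series M) - series M N.
  by apply: cvgB => //; exact: cvg_cst.
have cuN' : `|series u n - series u N| @[n --> \oo] -->
    `|limn (series u) - series u N| by exact: cvg_norm.
rewrite -(cvg_lim _ cuN')// -(cvg_lim _ cMN)//; apply: ler_lim.
- exact: cvgP cuN'.
- exact: cvgP cMN.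
exists N => // n /= Nn.
rewrite !sub_series_geq//; apply: (le_trans (ler_norm_sum _ _ _)).
exact: ler_sum.
Qed.

(** Three-epsilon argument: the tail of [M] controls the tail of the series at every point near [x],
    and a partial sum is continuous. Domination is asked only near [x], so that [M] may depend on
    [x]. *)
Lemma continuous_series (u : nat -> R -> R) M (x : R) :
  (\forall z \near x, forall n, `|u n z| <= M n) -> cvgn (series M) ->
  (forall n, {for x, continuous (u n)}) ->
  {for x, continuous (fun z => limn (series (u ^~ z)))}.
Proof.
move=> uM cM cu; apply/cvgrPdist_le => /= e e0.
have e30 : 0 < e / 3 by lra.
have [N _ HN] : \forall n \near \oo, `|limn (series M) - series M n| <= e / 3.
  by move/cvgrPdist_le : (cM); exact.
have cuN : {for x, continuous (fun z => series (u ^~ z) N)}.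
  elim: (N) => [|k IHk].
    rewrite (_ : (fun _ => _) = cst 0); first exact: cst_continuous.
    by apply/funext => z; rewrite seriesEnat/= big_geq.
  rewrite (_ : (fun _ => _) = fun z => series (u ^~ z) k + u k z).
    by apply: continuousD; [exact: IHk | exact: cu].
  by apply/funext => z; rewrite seriesSr.
have uMx := nbhs_singleton uM.
have {}HN z : (forall n, `|u n z| <= M n) ->
    `|limn (series (u ^~ z)) - series (u ^~ z) N| <= e / 3.
  move=> h; apply: (le_trans (tail_norm_le N h cM)).
  by apply: (le_trans (ler_norm _)); by apply: HN => /=.
near=> z.
have h1 : `|series (u ^~ x) N - series (u ^~ z) N| <= e / 3.
  by near: z; move/cvgrPdist_le : cuN; exact.
have h2 : `|limn (series (u ^~ z)) - series (u ^~ z) N| <= e / 3.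
  by apply: HN; near: z; exact: uM.
have h3 := HN _ uMx.
by move: h1 h2 h3; rewrite !ler_norml; lra.
Unshelve. all: by end_near. Qed.

Definition invsq (n : nat) : R := n.+1%:R ^- 2.

(** The partial sums are bounded by 2 - 1 / (k + 1), since 1 / (m + 1)^2 <= 1 / m - 1 / (m + 1). *)
Lemma cvg_series_invsq : cvgn (series invsq).
Proof.
apply: nondecreasing_is_cvgn.
  by apply: nondecreasing_series => n _ _; rewrite /invsq invr_ge0 exprn_ge0.
exists 2 => _ [n _ <-].
have step (m : R) : 0 < m -> 2 - m^-1 + (m + 1) ^- 2 <= 2 - (m + 1)^-1.
  move=> m0; rewrite -subr_ge0.
  have -> : 2 - (m + 1)^-1 - (2 - m^-1 + (m + 1) ^- 2) = (m * (m + 1) ^+ 2)^-1.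
    by field; rewrite !gt_eqF//; lra.
  by rewrite invr_ge0 mulr_ge0 ?sqr_ge0// ltW.
have inv k : series invsq k.+1 <= 2 - k.+1%:R^-1.
  elim: k => [|k IHk].
    by rewrite seriesEnat/= big_nat1 /invsq expr1n invr1; lra.
  rewrite seriesSr; apply: (le_trans (lerD IHk (lexx _))).
  by rewrite /invsq -[k.+2%:R]natr1; exact: step.
case: n => [|n]; first by rewrite seriesEnat/= big_geq.
by apply: (le_trans (inv n)); rewrite lerBlDr lerDl.
Qed.
End Series.

(** * Differential calculus in pointwise form *)

Section Derivatives.
Context {R : realType}.
Implicit Types (f g : R -> R) (x a b c : R).

Lemma is_deriveDf f g x a b : is_derive x 1 f a -> is_derive x 1 g b ->
  is_derive x 1 (fun z => f z + g z) (a + b).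
Proof. by move=> fa gb; exact: (is_deriveD fa gb). Qed.

Lemma is_deriveBf f g x a b : is_derive x 1 f a -> is_derive x 1 g b ->
  is_derive x 1 (fun z => f z - g z) (a - b).
Proof. by move=> fa gb; exact: (is_deriveB fa gb). Qed.

Lemma is_deriveMf f g x a b : is_derive x 1 f a -> is_derive x 1 g b ->
  is_derive x 1 (fun z => f z * g z) (a * g x + f x * b).
Proof.
move=> fa gb; apply: is_derive_eq (is_deriveM fa gb) _.
by rewrite /GRing.scale /= addrC mulrC [f x * b]mulrC mulrC [b * _]mulrC addrC.
Qed.

Lemma is_deriveZf f c x a : is_derive x 1 f a ->
  is_derive x 1 (fun z => c * f z) (c * a).
Proof. by move=> fa; exact: (is_deriveZ c fa). Qed.

Lemma is_deriveVf f x a : f x != 0 -> is_derive x 1 f a ->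
  is_derive x 1 (fun z => (f z)^-1) (- a / f x ^+ 2).
Proof.
move=> fx0 fa; apply: is_derive_eq (is_deriveV fx0 fa) _.
by rewrite /GRing.scale /= mulNr mulrC mulNr.
Qed.

Lemma is_derive_compf f g x a b : is_derive (g x) 1 f a ->
  is_derive x 1 g b -> is_derive x 1 (fun z => f (g z)) (a * b).
Proof. by move=> fa gb; exact: (is_derive1_comp fa gb). Qed.

Lemma is_derive_continuous f x a : is_derive x 1 f a -> {for x, continuous f}.
Proof.
by move=> [fx _]; apply: differentiable_continuous; exact/derivable1_diffP.
Qed.

Lemma continuousMf (f g : R -> R) : continuous f -> continuous g ->
  continuous (fun u => f u * g u).
Proof. by move=> cf cg u; exact: (continuousM (cf u) (cg u)). Qed.

Lemma continuousDf (f g : R -> R) : continuous f -> continuous g ->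
  continuous (fun u => f u + g u).
Proof. by move=> cf cg u; exact: (continuousD (cf u) (cg u)). Qed.

Lemma continuousBf (f g : R -> R) : continuous f -> continuous g ->
  continuous (fun u => f u - g u).
Proof. by move=> cf cg u; exact: (continuousB (cf u) (cg u)). Qed.

Lemma continuous_cst (c : R) : continuous (fun _ : R => c).
Proof. by move=> u; exact: cst_continuous. Qed.

Lemma ge0_derive_le f (f' : R -> R) a b : a <= b ->
  (forall z, a <= z <= b -> is_derive z 1 f (f' z)) ->
  (forall z, a <= z <= b -> 0 <= f' z) -> f a <= f b.
Proof.
move=> ab df f'0.
have [z||] := @MVT_segment _ f f' a b ab.
- by rewrite in_itv/= => /andP[/ltW az /ltW zb]; apply: df; rewrite az zb.
- apply: derivable_within_continuous => z; rewrite in_itv/= => zab.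
  by have [] := df z zab.
move=> c; rewrite in_itv/= => cab fE.
by rewrite -subr_ge0 fE mulr_ge0 ?f'0// subr_ge0.
Qed.

End Derivatives.

(** * The reciprocal Gamma function at 1 + it *)

Section ModulusArgument.
Context {R : realType}.
Implicit Types (t x : R).

(* Logarithm of the modulus of 1 + it / (k + 1). *)
Definition half_ln1sqr (k : nat) t : R := ln (1 + (t / k.+1%:R) ^+ 2) / 2.

(* Argument of 1 + it / (k + 1), corrected by the argument of n ^ (- it) split as
   a telescoping sum, so that the series converges. *)
Definition arg_term (k : nat) t : R :=
  atan (t / k.+1%:R) - t * (ln k.+2%:R - ln k.+1%:R).

(** Both inequalities compare derivatives. The quadratic upper bound is crude for small x, but it
    holds for all x >= 0 and is summable over x = t / (k + 1). *)
Lemma atan_sub_le_ge0 x : 0 <= x -> 0 <= x - atan x <= x ^+ 2.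
Proof.
move=> x0.
have dat (z : R) : is_derive z 1 (fun z : R => z - atan z) (1 - (1 + z ^+ 2)^-1).
  by apply: is_deriveBf; exact: is_derive_id.
have inv1 z : (1 + z ^+ 2)^-1 <= 1 :> R.
  by rewrite invf_le1 ?lerDl ?sqr_ge0// ltr_pwDl ?sqr_ge0.
apply/andP; split.
  have := @ge0_derive_le _ (fun z : R => z - atan z) _ 0 x x0 (fun z _ => dat z).
  by rewrite atan0 subr0; apply => z _; rewrite subr_ge0.
rewrite -subr_ge0.
have dsq (z : R) : is_derive z 1 (fun z : R => z ^+ 2 - (z - atan z))
    (2 * z - (1 - (1 + z ^+ 2)^-1)).
  apply: is_deriveBf => //.
  by apply: is_derive_eq; rewrite /GRing.scale /=; ring.
have := @ge0_derive_le _ _ _ 0 x x0 (fun z _ => dsq z).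
rewrite atan0 expr0n /= !subr0; apply => z /andP[z0 _].
(* The numerator is 2 z - z^2 + 2 z^3; completing the square makes each term nonnegative. *)
have -> : 2 * z - (1 - (1 + z ^+ 2)^-1) =
  (z + z * (1 - z) ^+ 2 + z ^+ 2 + z^+3) / (1 + z ^+ 2).
  have z1 : 1 + z ^+ 2 != 0 by rewrite gt_eqF// ltr_pwDl ?sqr_ge0.
  by field.
apply: divr_ge0; last by rewrite addr_ge0 ?sqr_ge0.
have h1 : 0 <= z * (1 - z) ^+ 2 by apply: mulr_ge0 => //; exact: sqr_ge0.
have h2 : 0 <= z ^+ 3 by exact: exprn_ge0.
by have := sqr_ge0 z; lra.
Qed.

Lemma atan_sub_norm_le x : `|atan x - x| <= x ^+ 2.
Proof.
have [x0|/ltW x0] := leP 0 x.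
  by have := atan_sub_le_ge0 x0; rewrite ler_norml; lra.
have := @atan_sub_le_ge0 (- x); rewrite oppr_ge0 => /(_ x0).
by rewrite atanN sqrrN ler_norml; lra.
Qed.

Lemma ln1D_sub_norm_le x : 0 <= x -> `|x - ln (1 + x)| <= x ^+ 2.
Proof.
move=> x0; have x1 : 0 < 1 + x by lra.
have h1 : ln (1 + x) <= x by apply: le_ln1Dx; lra.
(* This is ln (1 + y) <= y at y = - x / (1 + x), where 1 + y = 1 / (1 + x). *)
have h2 : - ln (1 + x) <= - (x / (1 + x)).
  have : -1 < - (x / (1 + x)) by rewrite ltrN2 ltr_pdivrMr//; lra.
  move/le_ln1Dx; rewrite -lnV ?posrE//.
  by rewrite (_ : 1 + - (x / (1 + x)) = (1 + x)^-1)//; field; lra.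
have h3 : x - x / (1 + x) <= x ^+ 2.
  rewrite (_ : x - x / (1 + x) = x ^+ 2 / (1 + x)); last by field; lra.
  by rewrite ler_pdivrMr// ler_peMr ?sqr_ge0//; lra.
by rewrite ler_norml; lra.
Qed.

Lemma half_ln1sqr_ge0 k t : 0 <= half_ln1sqr k t.
Proof. by rewrite /half_ln1sqr divr_ge0// ln_ge0// lerDl sqr_ge0. Qed.

Lemma half_ln1sqr_le k t : `|half_ln1sqr k t| <= t ^+ 2 * invsq k.
Proof.
rewrite ger0_norm ?half_ln1sqr_ge0// /half_ln1sqr /invsq -exprVn -exprMn.
have h : ln (1 + (t / k.+1%:R) ^+ 2) <= (t / k.+1%:R) ^+ 2.
  by apply: le_ln1Dx; apply: lt_le_trans (sqr_ge0 _); lra.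
rewrite ler_pdivrMr//; apply: (le_trans h).
by rewrite ler_peMr ?sqr_ge0//; lra.
Qed.

Lemma arg_term_le k t : `|arg_term k t| <= (t ^+ 2 + `|t|) * invsq k.
Proof.
have k0 : 0 < k.+1%:R :> R by [].
(* The linear part t / (k + 1) is common to the arctangent and to the logarithm; once it cancels,
   both remainders are O(1 / (k + 1)^2). *)
have -> : arg_term k t = (atan (t / k.+1%:R) - t / k.+1%:R) +
    t * (k.+1%:R^-1 - ln (1 + k.+1%:R^-1)).
  rewrite /arg_term -ln_div ?posrE// -[k.+2%:R]natr1 mulrDl divff ?gt_eqF//.
  by rewrite mul1r; ring.
apply: (le_trans (ler_normD _ _)); rewrite mulrDl; apply: lerD.
  by apply: (le_trans (atan_sub_norm_le _)); rewrite /invsq exprMn exprVn.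
rewrite normrM ler_wpM2l//.
by rewrite /invsq -exprVn; apply: ln1D_sub_norm_le; rewrite invr_ge0 ltW.
Qed.

End ModulusArgument.

Section ModulusArgumentSeries.
Context {R : realType}.
Implicit Types (t x : R).

(** [log_modulus t] and [argument t] are the real and imaginary parts of a logarithm of 1 / Gamma(1
    + it). As sums of series they are continuous in t, with no branch to choose. *)
Definition log_modulus t : R := limn (series (half_ln1sqr ^~ t)).
Definition argument t : R := limn (series (arg_term ^~ t)).

(** The left-hand side is a lower Riemann sum, with mesh 1 / t, of the integral of 1 / (1 + z^2)
    over [0, n / t]: the k-th term is 1 / t times the value at the right endpoint (k + 1) / t. *)
Lemma sum_atan_le n t : 0 < t ->
  \sum_(0 <= k < n) (t / (k.+1%:R ^+ 2 + t ^+ 2)) <= atan (n%:R / t).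
Proof.
move=> t0; elim: n => [|n IHn]; first by rewrite big_nil mul0r atan0.
rewrite big_nat_recr//= -lerBrDr; apply: (le_trans IHn).
set N : R := n.+1%:R.
pose D := t / (N ^+ 2 + t ^+ 2).
have ab : n%:R / t <= N / t by rewrite ler_pM2r ?invr_gt0// ler_nat.
have df (z : R) : is_derive z 1 (fun z : R => atan z - t * D * z)
    ((1 + z ^+ 2)^-1 - t * D).
  apply: is_deriveBf.
  by apply: is_derive_eq; rewrite /GRing.scale /= ?mulr1.
have := @ge0_derive_le _ _ _ _ _ ab (fun z _ => df z).
have -> : t * D * (N / t) = n%:R * D + D.
  by rewrite -[X in _ + X]mul1r -mulrDl natr1 -/N; field; rewrite gt_eqF.
have -> : t * D * (n%:R / t) = n%:R * D by field; rewrite gt_eqF.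
rewrite -/D => h; have {h} : atan (n%:R / t) - n%:R * D <= atan (N / t) - (n%:R * D + D).
  apply: h => z /andP[z0 zN].
  have z0' : 0 <= z by apply: le_trans z0; rewrite divr_ge0// ltW.
  have -> : t * D = (1 + (N / t) ^+ 2)^-1.
    rewrite /D; field; rewrite gt_eqF//= gt_eqF//.
    by rewrite ltr_pwDr ?sqr_ge0// exprn_gt0.
  rewrite subr_ge0 lef_pV2 ?posrE ?ltr_pwDl ?sqr_ge0// lerD2l lerXn2r//.
  by rewrite nnegrE (le_trans z0').
by lra.
Qed.

(* The derivative in t of the left-hand side is bounded by atan (n / t) <= pi / 2. *)
Lemma sum_half_ln1sqr_le n t :
  \sum_(0 <= k < n) half_ln1sqr k t <= pi * `|t| / 2.
Proof.
wlog t0 : t / 0 <= t.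
  move=> h; have [/h//|/ltW] := leP 0 t.
  rewrite -oppr_ge0 => /h; rewrite normrN.
  by under eq_bigr do rewrite /half_ln1sqr mulNr sqrrN.
rewrite ger0_norm//.
have dh (k : nat) (z : R) : is_derive z 1 (half_ln1sqr k) (z / (k.+1%:R ^+ 2 + z ^+ 2)).
  set m : R := k.+1%:R; have m0 : 0 < m by [].
  have z1 : 0 < 1 + (z / m) ^+ 2 by rewrite ltr_pwDl ?sqr_ge0.
  have z2 : 0 < m ^+ 2 + z ^+ 2 by rewrite ltr_pwDl ?sqr_ge0 ?exprn_gt0.
  have dsq : is_derive z 1 (fun z => 1 + (z / m) ^+ 2) (2 * z / m ^+ 2).
    rewrite (_ : (fun _ => _) = fun z => m ^- 2 * z ^+ 2 + 1); last first.
      by apply/funext => w; rewrite exprMn exprVn addrC mulrC.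
    apply: is_derive_eq; rewrite /GRing.scale /=; field; lra.
  have dln := @is_derive_compf _ (@ln R) (fun z => 1 + (z / m) ^+ 2) _ _ _ (is_derive1_ln z1) dsq.
  have := is_deriveMf dln (is_derive_cst (2^-1 : R) z 1).
  move=> h; apply: is_derive_eq h _.
  rewrite /cst /= mulr0 addr0.
  clear dsq dln; clearbody m.
  by field; rewrite !gt_eqF.
have ds (z : R) : is_derive z 1 (fun z => pi / 2 * z - \sum_(0 <= k < n) half_ln1sqr k z)
    (pi / 2 - \sum_(0 <= k < n) (z / (k.+1%:R ^+ 2 + z ^+ 2))).
  apply: is_deriveBf; first by apply: is_derive_eq; rewrite /GRing.scale /= mulr1.
  elim: n => [|n IHn].
    rewrite big_nil (_ : (fun _ => _) = cst 0); first exact: is_derive_cst.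
    by apply/funext => w; rewrite big_nil.
  rewrite big_nat_recr//= (_ : (fun _ => _) =
    fun z => \sum_(0 <= k < n) half_ln1sqr k z + half_ln1sqr n z).
    exact: is_deriveDf.
  by apply/funext => w; rewrite big_nat_recr.
have := @ge0_derive_le _ _ _ _ _ t0 (fun z _ => ds z).
rewrite mulr0 big1; last first.
  by move=> k _; rewrite /half_ln1sqr mul0r expr0n/= addr0 ln1 mul0r.
rewrite subrr subr_ge0 mulrAC; apply => z /andP[z0 _].
move: z0; rewrite le_eqVlt => /predU1P[<-|z0].
  by rewrite big1 ?subr0 ?divr_ge0 ?pi_ge0// => k _; rewrite mul0r.
rewrite subr_ge0; apply: (le_trans (sum_atan_le n z0)).
exact: ltW (atan_ltpi2 _).
Qed.

Lemma cvg_log_modulus t : series (half_ln1sqr ^~ t) @ \oo --> log_modulus t.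
Proof.
apply: (normed_le_cvg (fun k => half_ln1sqr_le k t)).
exact/is_cvg_seriesZ/cvg_series_invsq.
Qed.

Lemma cvg_argument t : series (arg_term ^~ t) @ \oo --> argument t.
Proof.
apply: (normed_le_cvg (fun k => arg_term_le k t)).
exact/is_cvg_seriesZ/cvg_series_invsq.
Qed.

Lemma log_modulus_le t : log_modulus t <= pi * `|t| / 2.
Proof.
apply: limr_le; first by apply/cvg_ex; exists (log_modulus t); exact: cvg_log_modulus.
by apply: nearW => n; exact: sum_half_ln1sqr_le.
Qed.

(** What matters is the first-order vanishing at t = 0: it makes sin (argument t) of order min(1,
    |t|). *)
Lemma argument_le : exists2 C : R, 0 <= C &
  forall t, `|argument t| <= C * (t ^+ 2 + `|t|).
Proof.
exists (limn (series (@invsq R))).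
  apply: limr_ge; first exact: cvg_series_invsq.
  by apply: nearW => n; apply: sumr_ge0 => k _; rewrite invr_ge0 sqr_ge0.
move=> t; apply: (le_trans (lim_norm_le (fun k => arg_term_le k t) _)).
  exact/is_cvg_seriesZ/cvg_series_invsq.
by rewrite lim_seriesZ//; [rewrite mulrC | exact: cvg_series_invsq].
Qed.

Lemma near_norm_le t : \forall z \near t, `|z| <= `|t| + 1.
Proof.
near=> z; have h : `|t - z| <= 1.
  by near: z; exact: (@cvgr_dist_le _ _ _ _ (nbhs_filter t) id t cvg_id 1 ltr01).
by rewrite -lerBlDl (le_trans _ h)// (le_trans (lerB_dist _ _))// distrC.
Unshelve. all: by end_near. Qed.

Lemma continuous_log_modulus : continuous log_modulus.
Proof.
move=> t; apply: (@continuous_series _ _ (fun k => (`|t| + 1) ^+ 2 * invsq k)).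
- near=> z => k; apply: (le_trans (half_ln1sqr_le k z)).
  rewrite ler_wpM2r ?invr_ge0 ?sqr_ge0// -real_normK ?num_real// lerXn2r//.
    by rewrite nnegrE addr_ge0.
  by near: z; exact: near_norm_le.
- exact/is_cvg_seriesZ/cvg_series_invsq.
move=> k; apply: (@continuousM _ _ _ (cst _)) => //; last exact: cst_continuous.
apply: (@continuous_comp _ _ _ (fun t => 1 + (t / k.+1%:R) ^+ 2) (@ln R)).
  apply: continuousD; first exact: cst_continuous.
  by apply: (@continuous_comp _ _ _ (fun t : R => t / k.+1%:R) (fun t => t ^+ 2));
    [apply: continuousM => //; exact: cst_continuous | exact: exprn_continuous].
by apply: continuous_ln; rewrite ltr_pwDl ?sqr_ge0.
Unshelve. all: by end_near. Qed.

Lemma continuous_argument : continuous argument.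
Proof.
move=> t; apply: (@continuous_series _ _
  (fun k => ((`|t| + 1) ^+ 2 + (`|t| + 1)) * invsq k)).
- near=> z => k; apply: (le_trans (arg_term_le k z)).
  have zt : `|z| <= `|t| + 1 by near: z; exact: near_norm_le.
  rewrite ler_wpM2r ?invr_ge0 ?sqr_ge0// lerD// -real_normK ?num_real// lerXn2r//.
  by rewrite nnegrE addr_ge0.
- exact/is_cvg_seriesZ/cvg_series_invsq.
move=> k; apply: continuousB; last first.
  by apply: continuousM => //; exact: cst_continuous.
apply: (@continuous_comp _ _ _ (fun t : R => t / k.+1%:R) (@atan R)).
  by apply: continuousM => //; exact: cst_continuous.
exact: continuous_atan.
Unshelve. all: by end_near. Qed.

End ModulusArgumentSeries.

Local Open Scope complex_scope.

(** * Componentwise limits and the complex exponential *)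

Section ComplexLimits.
Context {R : realType}.
Implicit Types (z w : R[i]) (u v : nat -> R[i]).

Definition ccvgn u z : Prop :=
  (complex.Re (u n) @[n --> \oo] --> complex.Re z) /\
  (complex.Im (u n) @[n --> \oo] --> complex.Im z).

Lemma climn_eq u z : ccvgn u z -> climn u = z.
Proof.
move=> [cr ci]; rewrite /climn (cvg_lim _ cr)// (cvg_lim _ ci)//.
by case: z {cr ci}.
Qed.

Lemma ccvgn_cst z : ccvgn (fun=> z) z.
Proof. by split; exact: cvg_cst. Qed.

Lemma complex_ReM z w : complex.Re (z * w) =
  complex.Re z * complex.Re w - complex.Im z * complex.Im w.
Proof. by case: z; case: w. Qed.

Lemma complex_ImM z w : complex.Im (z * w) =
  complex.Re z * complex.Im w + complex.Im z * complex.Re w.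
Proof. by case: z => a b; case: w => c d /=. Qed.

Lemma complex_ReD z w : complex.Re (z + w) = complex.Re z + complex.Re w.
Proof. by case: z; case: w. Qed.

Lemma complex_ImD z w : complex.Im (z + w) = complex.Im z + complex.Im w.
Proof. by case: z; case: w. Qed.

Lemma Re_real (x : R) : complex.Re x%:C = x. Proof. by []. Qed.
Lemma Im_real (x : R) : complex.Im x%:C = 0. Proof. by []. Qed.

Lemma ccvgnM u v z w : ccvgn u z -> ccvgn v w ->
  ccvgn (fun n => u n * v n) (z * w).
Proof.
move=> [ur ui] [vr vi]; split.
  rewrite complex_ReM; under eq_fun do rewrite complex_ReM.
  by apply: cvgB; exact: cvgM.
rewrite complex_ImM; under eq_fun do rewrite complex_ImM.
by apply: cvgD; exact: cvgM.
Qed.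

Lemma eq_ccvgn u v z : (\forall n \near \oo, u n = v n) -> ccvgn u z -> ccvgn v z.
Proof.
move=> uv [ur ui]; split; [move: ur | move: ui]; apply: cvg_trans;
  apply: near_eq_cvg; near=> n; congr (_ _); near: n => //.
Unshelve. all: by end_near. Qed.

Lemma cexpD z w : cexp (z + w) = cexp z * cexp w.
Proof.
case: z => a b; case: w => c d; rewrite /cexp /= expRD sinD cosD.
by apply/eqP; rewrite eq_complex /=; apply/andP; split; apply/eqP; ring.
Qed.

Lemma cexp0 : cexp (0 : R[i]) = 1.
Proof.
rewrite /cexp /= expR0 cos0 sin0.
by apply/eqP; rewrite eq_complex /=; apply/andP; split; apply/eqP; ring.
Qed.

Lemma cexp_neq0 z : cexp z != 0.
Proof.
apply/eqP => z0; have := cexpD z (- z).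
by rewrite subrr cexp0 z0 mul0r => /eqP; rewrite oner_eq0.
Qed.

Lemma cexp_real (x : R) : cexp x%:C = (expR x)%:C.
Proof.
by rewrite /cexp /= cos0 sin0 complexr0 mulr1.
Qed.

Lemma ccvgn_cexp u z : ccvgn u z -> ccvgn (fun n => cexp (u n)) (cexp z).
Proof.
have E w : cexp w = (expR (complex.Re w) * cos (complex.Im w)) +i*
    (expR (complex.Re w) * sin (complex.Im w)).
  by apply/eqP; rewrite eq_complex /=; apply/andP; split; apply/eqP; ring.
move=> [ur ui]; split; rewrite E; under eq_fun do rewrite E; apply: cvgM.
- by apply: (@continuous_cvg _ _ _ _ _ _ (@expR R)) => //; exact: continuous_expR.
- by apply: (@continuous_cvg _ _ _ _ _ _ (@cos R)) => //; exact: continuous_cos.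
- by apply: (@continuous_cvg _ _ _ _ _ _ (@expR R)) => //; exact: continuous_expR.
- by apply: (@continuous_cvg _ _ _ _ _ _ (@sin R)) => //; exact: continuous_sin.
Qed.

Lemma natc (n : nat) : (n%:R : R[i]) = (n%:R : R)%:C.
Proof. by rewrite rmorph_nat. Qed.

Lemma cexp_polar (x : R) :
  1 +i* x = cexp ((ln (1 + x ^+ 2) / 2) +i* atan x).
Proof.
have x1 : 0 < 1 + x ^+ 2 by rewrite ltr_pwDl ?sqr_ge0.
have s0 : Num.sqrt (1 + x ^+ 2) != 0 by rewrite gt_eqF ?sqrtr_gt0.
rewrite /cexp /=; have -> : sin (atan x) = x * cos (atan x).
  have h := atanK x; rewrite /tan in h.
  by rewrite -[X in X * _]h divfK// cos_atan invr_eq0.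
rewrite cos_atan.
have -> : expR (ln (1 + x ^+ 2) / 2) = Num.sqrt (1 + x ^+ 2).
  by rewrite -powR12_sqrt ?ltW// /powR gt_eqF// mulrC.
by apply/eqP; rewrite eq_complex /=; apply/andP; split; apply/eqP; field.
Qed.

End ComplexLimits.

(** * Gauss's limit at 1 + it and at it + k + 1 *)

Section ReciprocalGamma.
Context {R : realType}.
Implicit Types (t : R) (z : R[i]).

Definition gauss_seq z (n : nat) : R[i] :=
  (\prod_(0 <= k < n.+1) (z + k%:R)) / ((n`!)%:R * cpow n%:R z).

Definition rGamma1 t : R[i] := cexp (log_modulus t +i* argument t).

Lemma prod_polar t n : \prod_(0 <= k < n) (0 +i* t + 1 + k%:R) =
  (n`!)%:R * cexp (series (half_ln1sqr ^~ t) n +i*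
    (\sum_(0 <= k < n) atan (t / k.+1%:R))).
Proof.
elim: n => [|n IHn].
  by rewrite !big_geq// fact0 mul1r seriesEnat/= big_geq// cexp0.
rewrite big_nat_recr//= IHn seriesSr [in RHS]big_nat_recr//=.
have -> : (0 +i* t + 1 + n%:R : R[i]) = n.+1%:R * (1 +i* (t / n.+1%:R)).
  rewrite [n.+1%:R]natc; apply/eqP; rewrite eq_complex /= natc /=.
  by apply/andP; split; apply/eqP;
    rewrite ?mul0r ?subr0 ?addr0 ?add0r ?mulr1 -?natr1; field.
have -> (a b c d : R) : (a + c) +i* (b + d) = (a +i* b) + (c +i* d) by [].
by rewrite cexp_polar cexpD factS natrM /half_ln1sqr; ring.
Qed.

(** The product has n + 1 factors. Its moduli contribute (n + 1)!, against n! n in the denominator,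
    and the logarithms in [arg_term] telescope to ln (n + 2), against ln n. The two mismatches are
    the outer factors, both of which tend to 1. *)
Lemma gauss_seq1 t n : (0 < n)%N -> gauss_seq (0 +i* t + 1) n =
  (1 + n%:R^-1)%:C * cexp (series (half_ln1sqr ^~ t) n.+1 +i*
     series (arg_term ^~ t) n.+1) * cexp (0 +i* (t * (ln n.+2%:R - ln n%:R))).
Proof.
move=> n0; rewrite /gauss_seq prod_polar.
have -> : cpow n%:R (0 +i* t + 1) = n%:R * cexp (0 +i* (t * ln n%:R)) :> R[i].
  rewrite /cpow mulrDr mulr1 addrC cexpD cexp_real lnK ?posrE ?ltr0n//.
  rewrite -natc; congr (_ * cexp _).
  by apply/eqP; rewrite eq_complex /=; apply/andP; split; apply/eqP; ring.
have -> : cexp (series (half_ln1sqr ^~ t) n.+1 +i*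
    \sum_(0 <= k < n.+1) atan (t / k.+1%:R)) =
  cexp (series (half_ln1sqr ^~ t) n.+1 +i* series (arg_term ^~ t) n.+1) *
  cexp (0 +i* (t * ln n.+2%:R)).
  rewrite -cexpD; congr cexp; apply/eqP; rewrite eq_complex /= addr0 eqxx/=.
  rewrite seriesEnat /= /arg_term sumrB -mulr_sumr.
  rewrite (telescope_sumr (fun k => ln (k.+1%:R : R)))// ln1 subr0.
  by rewrite subrK.
have -> : cexp (0 +i* (t * (ln n.+2%:R - ln n%:R))) =
   cexp (0 +i* (t * ln n.+2%:R)) / cexp (0 +i* (t * ln n%:R)) :> R[i].
  apply: (mulIf (cexp_neq0 (0 +i* (t * ln n%:R)))).
  rewrite divfK ?cexp_neq0// -cexpD; congr cexp.
  by apply/eqP; rewrite eq_complex /=; apply/andP; split; apply/eqP; ring.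
have -> : (1 + n%:R^-1)%:C = n.+1%:R / n%:R :> R[i].
  by rewrite rmorphD /= rmorphV ?unitfE ?pnatr_eq0 -?lt0n//= rmorph_nat -natr1; field;
    rewrite pnatr_eq0 -lt0n.
rewrite factS natrM; field.
by rewrite !cexp_neq0 !pnatr_eq0 -!lt0n n0 fact_gt0.
Qed.

Lemma cvg_gauss_seq1 t : ccvgn (gauss_seq (0 +i* t + 1)) (rGamma1 t).
Proof.
have -> : rGamma1 t = 1 * rGamma1 t * cexp 0 by rewrite cexp0 mulr1 mul1r.
apply: (@eq_ccvgn _ (fun n => (1 + n%:R^-1)%:C * cexp (series (half_ln1sqr ^~ t) n.+1 +i*
     series (arg_term ^~ t) n.+1) * cexp (0 +i* (t * (ln n.+2%:R - ln n%:R))))).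
  by exists 1%N => // n n0; rewrite (gauss_seq1 _ n0).
have inv0 : (n%:R : R)^-1 @[n --> \oo] --> 0.
  by rewrite -cvg_shiftS; exact: cvg_harmonic.
apply: ccvgnM; first apply: ccvgnM.
- split; last exact: cvg_cst.
  rewrite -[X in _ --> X]addr0; apply: cvgD => //; exact: cvg_cst.
- apply: ccvgn_cexp; split => /=.
  + by rewrite (cvg_shiftS (series (half_ln1sqr ^~ t))); exact: cvg_log_modulus.
  + by rewrite (cvg_shiftS (series (arg_term ^~ t))); exact: cvg_argument.
apply: ccvgn_cexp; split => /=; first exact: cvg_cst.
rewrite -[X in _ --> X](mulr0 t); apply: cvgM; first exact: cvg_cst.
have : ln (1 + 2 * (n%:R : R)^-1) @[n --> \oo] --> ln 1.
  apply: (@continuous_cvg _ _ _ _ _ _ (@ln R)); first exact: continuous_ln.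
  rewrite -[X in _ --> X]addr0 -[X in 1 + X](mulr0 2).
  by apply: cvgD; [exact: cvg_cst | apply: cvgM => //; exact: cvg_cst].
rewrite ln1; apply: cvg_trans; apply: near_eq_cvg.
exists 1%N => // n /= n0; rewrite -ln_div ?posrE ?ltr0n//; congr ln.
by rewrite -[n.+2%:R]natr1 -[n.+1%:R]natr1; field; rewrite pnatr_eq0 -lt0n.
Qed.

(** The functional equation 1 / Gamma(z + 1) = 1 / (z Gamma(z)) before the limit: shifting z
    replaces the factor z by z + n + 1 and brings one more n into the denominator. Starting from 1 +
    it, it reaches every order in the series of J_(it). *)
Lemma gauss_seqS z n : z != 0 -> (0 < n)%N ->
  gauss_seq (z + 1) n = gauss_seq z n * ((1 + (z + 1) * (n%:R^-1)%:C) / z).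
Proof.
move=> z0 n0; rewrite /gauss_seq.
have -> : cpow n%:R (z + 1) = n%:R * cpow n%:R z :> R[i].
  by rewrite /cpow mulrDr mulr1 addrC cexpD cexp_real lnK ?posrE ?ltr0n// -natc.
have -> : \prod_(0 <= k < n.+1) (z + 1 + k%:R) =
    (\prod_(0 <= k < n.+1) (z + k%:R)) * (z + n.+1%:R) / z.
  rewrite -(big_nat_recr _ _ (fun k => z + k%:R))//= [in RHS]big_nat_recl// mulr0n addr0.
  rewrite [z * _]mulrC mulfK//; apply: eq_bigr => k _.
  by rewrite -addrA nat1r.
rewrite rmorphV ?unitfE ?pnatr_eq0 -?lt0n//= rmorph_nat -[n.+1%:R]natr1.
field.
by rewrite z0 /cpow cexp_neq0 !pnatr_eq0 -!lt0n n0 fact_gt0.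
Qed.

Lemma cvg_gauss_seqS z w : z != 0 -> ccvgn (gauss_seq z) w ->
  ccvgn (gauss_seq (z + 1)) (w / z).
Proof.
move=> z0 zw.
apply: (@eq_ccvgn _ (fun n => gauss_seq z n * ((1 + (z + 1) * (n%:R^-1)%:C) / z))).
  by exists 1%N => // n n0; rewrite gauss_seqS.
apply: ccvgnM => //; rewrite -[X in ccvgn _ X]mul1r; apply: ccvgnM; last exact: ccvgn_cst.
have inv0 : (n%:R : R)^-1 @[n --> \oo] --> 0.
  by rewrite -cvg_shiftS; exact: cvg_harmonic.
split.
  rewrite (_ : (fun _ => _) = fun n => 1 + complex.Re (z + 1) * (n%:R)^-1).
    have -> : complex.Re (1 : R[i]) = 1 + complex.Re (z + 1) * 0 by rewrite mulr0 addr0.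
    by apply: cvgD; [exact: cvg_cst | apply: cvgM => //; exact: cvg_cst].
  by apply/funext => n; rewrite [LHS]complex_ReD complex_ReM Re_real Im_real mulr0 subr0.
rewrite (_ : (fun _ => _) = fun n => 0 + complex.Im (z + 1) * (n%:R)^-1).
  have -> : complex.Im (1 : R[i]) = 0 + complex.Im (z + 1) * 0 by rewrite mulr0 addr0.
  by apply: cvgD; [exact: cvg_cst | apply: cvgM => //; exact: cvg_cst].
by apply/funext => n; rewrite [LHS]complex_ImD complex_ImM Re_real Im_real mulr0 add0r.
Qed.

Lemma imaginary_natS_neq0 t k : (0 +i* t + k.+1%:R : R[i]) != 0.
Proof. by rewrite eq_complex natc /= add0r pnatr_eq0. Qed.

Lemma cvg_gauss_seq t k : ccvgn (gauss_seq (0 +i* t + k%:R + 1))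
  (rGamma1 t / \prod_(0 <= j < k) (0 +i* t + j.+1%:R)).
Proof.
elim: k => [|k IHk].
  by rewrite big_geq// divr1 addr0; exact: cvg_gauss_seq1.
rewrite big_nat_recr// invfM mulrA; apply: cvg_gauss_seqS.
  exact: imaginary_natS_neq0.
by rewrite -natr1 addrA.
Qed.

Lemma rGammaE t k : rGamma (0 +i* t + k%:R + 1) =
  rGamma1 t / \prod_(0 <= j < k) (0 +i* t + j.+1%:R).
Proof. exact: climn_eq (cvg_gauss_seq t k). Qed.

End ReciprocalGamma.

(** * Power series with coefficients O(1 / i!) *)

Section FactorialSeries.
Context {R : realType}.
Implicit Types (c : nat -> R) (s C : R).

Definition ps c s : R := limn (pseries c s).

Lemma fact_bound_term c C s i : (forall i, `|c i| <= C / i`!%:R) ->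
  `|c i * s ^+ i| <= C * exp_coeff `|s| i.
Proof.
move=> cC; rewrite normrM normrX /exp_coeff /=.
by rewrite [_ / _]mulrC mulrA ler_wpM2r// exprn_ge0.
Qed.

Lemma cvg_pseries c C s : (forall i, `|c i| <= C / i`!%:R) ->
  cvgn (pseries c s).
Proof.
move=> cC; apply: (normed_le_cvg (fun i => fact_bound_term s i cC)).
exact/is_cvg_seriesZ/is_cvg_series_exp_coeff.
Qed.

Lemma ps_norm_le c C s : (forall i, `|c i| <= C / i`!%:R) ->
  `|ps c s| <= C * expR `|s|.
Proof.
move=> cC; apply: (le_trans (lim_norm_le (fun i => fact_bound_term s i cC) _)).
  exact/is_cvg_seriesZ/is_cvg_series_exp_coeff.
by rewrite lim_seriesZ//; exact: is_cvg_series_exp_coeff.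
Qed.

(** The bound C / i! is stable under formal differentiation, with the same C. One hypothesis thus
    gives convergence everywhere, the bound C exp |s| and termwise differentiation, for a series and
    all its derivatives. *)
Lemma fact_bound_diffs c C : (forall i, `|c i| <= C / i`!%:R) ->
  forall i, `|pseries_diffs c i| <= C / i`!%:R.
Proof.
move=> cC i; rewrite /pseries_diffs normrM ger0_norm//.
apply: (le_trans (ler_wpM2l _ (cC i.+1))) => //.
by rewrite factS natrM invfM !mulrA [_ * C]mulrC mulfK ?pnatr_eq0.
Qed.

Lemma is_derive_ps c C s : (forall i, `|c i| <= C / i`!%:R) ->
  is_derive s 1 (ps c) (ps (pseries_diffs c) s).
Proof.
move=> cC; have dC := fact_bound_diffs cC; have ddC := fact_bound_diffs dC.
apply: (@pseries_snd_diffs _ c (`|s| + 1)).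
- exact: cvg_pseries cC.
- exact: cvg_pseries dC.
- exact: cvg_pseries ddC.
- by rewrite [X in _ < X]ger0_norm ?addr_ge0// ltrDl.
Qed.

(** Multiplying the derivative by s realigns the powers, so that the differential equation can be
    checked on partial sums term by term. *)
Lemma cvg_mul_pseries_diffs c C s : (forall i, `|c i| <= C / i`!%:R) ->
  series (fun i => i%:R * c i * s ^+ i) @ \oo --> s * ps (pseries_diffs c) s.
Proof.
move=> cC; have dC := fact_bound_diffs cC.
have h := pseries_diffs_equiv (cvg_pseries (s := s) dC).
rewrite (_ : series _ = fun n => s * series (fun i => i%:R * c i * s ^+ i.-1) n).
  by apply: cvgM => //; exact: cvg_cst.
apply/funext => n; rewrite /series /= mulr_sumr; apply: eq_bigr => -[|i] _.
  by rewrite !mul0r mulr0.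
by rewrite exprS; ring.
Qed.

Lemma continuous_ps (c : nat -> R -> R) C s (t : R) :
  (\forall z \near t, forall i, `|c i z| <= C / i`!%:R) ->
  (forall i, {for t, continuous (c i)}) ->
  {for t, continuous (fun z => ps (c ^~ z) s)}.
Proof.
move=> cC cc; apply: (@continuous_series _ (fun i z => c i z * s ^+ i)
  (fun i => C * exp_coeff `|s| i)).
- near=> z => i; apply: (fact_bound_term (c := c ^~ z)).
  by near: z.
- exact/is_cvg_seriesZ/is_cvg_series_exp_coeff.
by move=> i; apply: continuousM; [exact: cc | exact: cst_continuous].
Unshelve. all: by end_near. Qed.

End FactorialSeries.

(** * The ascending series *)

Section BesselCoefficients.
Context {R : realType}.
Implicit Types (t s y : R).

(* Coefficient of (x / 2) ^ (it + 2 k) in J_(it), up to the factor 1 / Gamma(1 + it). *)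
Definition bessel_coef t k : R[i] :=
  (-1) ^+ k / (k`!)%:R / \prod_(0 <= j < k) (0 +i* t + j.+1%:R).

Definition coefRe k t : R := complex.Re (bessel_coef t k).
Definition coefIm k t : R := complex.Im (bessel_coef t k).

Lemma bessel_coefS t k : bessel_coef t k.+1 * (k.+1%:R * (0 +i* t + k.+1%:R)) =
  - bessel_coef t k.
Proof.
rewrite /bessel_coef big_nat_recr// factS natrM exprS.
have P0 : \prod_(0 <= j < k) (0 +i* t + j.+1%:R) != 0 :> R[i].
  by rewrite prodf_seq_neq0; apply/allP => j _; rewrite imaginary_natS_neq0.
have z0 := imaginary_natS_neq0 t k.
have k0 : (k`!)%:R != 0 :> R[i] by rewrite pnatr_eq0 -lt0n fact_gt0.
have k1 : k.+1%:R != 0 :> R[i] by rewrite pnatr_eq0.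
have key (P z f m e : R[i]) : P != 0 -> z != 0 -> f != 0 -> m != 0 ->
    - 1 * e / (m * f) / (P * z) * (m * z) = - (e / f / P).
  by move=> ? ? ? ?; field; apply/and4P.
exact: key.
Qed.

Lemma coefRe0 t : coefRe 0 t = 1.
Proof. by rewrite /coefRe /bessel_coef big_geq// fact0 !divr1. Qed.

Lemma coefIm0 t : coefIm 0 t = 0.
Proof. by rewrite /coefIm /bessel_coef big_geq// fact0 !divr1. Qed.

Lemma coef_recRe k t : k.+1%:R * (coefRe k.+1 t * k.+1%:R - coefIm k.+1 t * t) =
  - coefRe k t.
Proof.
have := congr1 (@complex.Re R) (bessel_coefS t k).
by rewrite natc /coefRe /coefIm; case: (bessel_coef t k.+1) => a b;
  case: (bessel_coef t k) => c d /= <-; ring.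
Qed.

Lemma coef_recIm k t : k.+1%:R * (coefRe k.+1 t * t + coefIm k.+1 t * k.+1%:R) =
  - coefIm k t.
Proof.
have := congr1 (@complex.Im R) (bessel_coefS t k).
by rewrite natc /coefRe /coefIm; case: (bessel_coef t k.+1) => a b;
  case: (bessel_coef t k) => c d /= <-; ring.
Qed.

Lemma coefReS k t : coefRe k.+1 t =
  - (coefRe k t * k.+1%:R + coefIm k t * t) / (k.+1%:R * (k.+1%:R ^+ 2 + t ^+ 2)).
Proof.
have := coef_recRe k t; have := coef_recIm k t.
have : 0 < k.+1%:R :> R by [].
move: (coefRe k t) (coefIm k t) (coefRe k.+1 t) (coefIm k.+1 t) => a b a' b'.
move: k.+1%:R => m m0 e1 e2.
have D0 : 0 < m ^+ 2 + t ^+ 2 by rewrite ltr_pwDl ?sqr_ge0 ?exprn_gt0.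
have -> : a = - (m * (a' * m - b' * t)) by rewrite e2 opprK.
have -> : b = - (m * (a' * t + b' * m)) by rewrite e1 opprK.
by field; rewrite !gt_eqF.
Qed.

Lemma coefImS k t : coefIm k.+1 t =
  (coefRe k t * t - coefIm k t * k.+1%:R) / (k.+1%:R * (k.+1%:R ^+ 2 + t ^+ 2)).
Proof.
have := coef_recRe k t; have := coef_recIm k t.
have : 0 < k.+1%:R :> R by [].
move: (coefRe k t) (coefIm k t) (coefRe k.+1 t) (coefIm k.+1 t) => a b a' b'.
move: k.+1%:R => m m0 e1 e2.
have D0 : 0 < m ^+ 2 + t ^+ 2 by rewrite ltr_pwDl ?sqr_ge0 ?exprn_gt0.
have -> : a = - (m * (a' * m - b' * t)) by rewrite e2 opprK.
have -> : b = - (m * (a' * t + b' * m)) by rewrite e1 opprK.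
by field; rewrite !gt_eqF.
Qed.

(** Since |k + 1 + it| >= k + 1, each step of the recurrence divides the modulus by at least (k +
    1)^2, whatever t is. *)
Lemma coef_sqr_le k t :
  coefRe k t ^+ 2 + coefIm k t ^+ 2 <= ((k`!)%:R ^- 2) ^+ 2.
Proof.
elim: k => [|k IHk].
  by rewrite coefRe0 coefIm0 fact0 expr0n/= addr0 !expr1n invr1 expr1n.
rewrite factS natrM exprMn invfM exprMn.
have m0 : 0 < k.+1%:R :> R by [].
have := coef_recRe k t; have := coef_recIm k t; move: IHk.
move: (coefRe k t) (coefIm k t) (coefRe k.+1 t) (coefIm k.+1 t) => a b a' b'.
move: m0; move: k.+1%:R (_ ^- 2 : R) => m f m0 IHk e1 e2.
have e : m ^+ 2 * (m ^+ 2 + t ^+ 2) * (a' ^+ 2 + b' ^+ 2) = a ^+ 2 + b ^+ 2.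
  by rewrite -[a]opprK -[b]opprK -e1 -e2; ring.
have h : (a' ^+ 2 + b' ^+ 2) * m ^+ 4 <= f ^+ 2.
  apply: le_trans IHk; rewrite -e.
  have : 0 <= m ^+ 2 * t ^+ 2 * (a' ^+ 2 + b' ^+ 2).
    by apply: mulr_ge0; [rewrite -exprMn sqr_ge0 | rewrite addr_ge0 ?sqr_ge0].
  move=> h; rewrite -subr_ge0; apply: le_trans h _.
  by rewrite le_eqVlt; apply/orP; left; apply/eqP; ring.
have -> : (m ^- 2) ^+ 2 = (m ^+ 4)^-1 by rewrite -exprVn -exprM exprVn.
by rewrite mulrC ler_pdivlMr// exprn_gt0.
Qed.

Lemma coefRe_le k t : `|coefRe k t| <= (k`!)%:R ^- 2.
Proof.
rewrite -ler_sqr ?nnegrE ?invr_ge0 ?exprn_ge0// real_normK ?num_real//.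
by apply: le_trans (coef_sqr_le k t); rewrite lerDl sqr_ge0.
Qed.

Lemma coefIm_le1 k t : `|coefIm k t| <= (k`!)%:R ^- 2.
Proof.
rewrite -ler_sqr ?nnegrE ?invr_ge0 ?exprn_ge0// real_normK ?num_real//.
by apply: le_trans (coef_sqr_le k t); rewrite lerDr sqr_ge0.
Qed.

(** The coefficients are real at t = 0; this is the quantitative form. It is the source of the
    factor |t| that compensates the zero of sinh (pi t / 2). With m = k + 1, the induction reduces
    to 1 + (m - 1) m <= m^2 + t^2. *)
Lemma coefIm_let k t : `|coefIm k t| <= `|t| * (k%:R * (k`!)%:R ^- 2).
Proof.
elim: k => [|k IHk]; first by rewrite coefIm0 normr0 mul0r mulr0.
rewrite coefImS factS natrM exprMn [in leRHS]invfM.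
have m1 : 1 <= k.+1%:R :> R by rewrite ler1n.
have km : (k%:R : R) = k.+1%:R - 1 by rewrite -natr1 addrK.
have f0 : 0 <= (k`!)%:R ^- 2 :> R by rewrite invr_ge0 exprn_ge0.
rewrite {}km in IHk; move: IHk (coefRe_le k t) m1 f0.
move: (coefRe k t) (coefIm k t) k.+1%:R (_ ^- 2 : R) => a b m f hb ha m1 f0.
have m0 : 0 < m by lra.
have D0 : 0 < m ^+ 2 + t ^+ 2 by rewrite ltr_pwDl ?sqr_ge0 ?exprn_gt0.
rewrite normrM normfV [X in _ / X]gtr0_norm ?mulr_gt0// ler_pdivrMr ?mulr_gt0//.
apply: (le_trans (ler_normB _ _)); rewrite !normrM [`|m|]gtr0_norm//.
have h1 : `|a| * `|t| <= f * `|t| by rewrite ler_wpM2r.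
have h2 : `|b| * m <= `|t| * ((m - 1) * f) * m by rewrite ler_wpM2r// ltW.
apply: (le_trans (lerD h1 h2)).
have -> : `|t| * (m * (m ^- 2 * f)) * (m * (m ^+ 2 + t ^+ 2)) =
  `|t| * f * (m ^+ 2 + t ^+ 2) by field; rewrite gt_eqF.
have -> : f * `|t| + `|t| * ((m - 1) * f) * m = `|t| * f * (1 + (m - 1) * m) by ring.
rewrite ler_wpM2l ?mulr_ge0//.
by have := sqr_ge0 t; nra.
Qed.

Lemma sqr_invf_le (k : nat) : (k`!)%:R ^- 2 <= (k`!)%:R^-1 :> R.
Proof.
have k1 : 1 <= (k`!)%:R :> R by rewrite ler1n fact_gt0.
rewrite lef_pV2 ?posrE ?exprn_gt0 ?(lt_le_trans ltr01)//.
by rewrite expr2 ler_peMl// (le_trans ler01).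
Qed.

Lemma natM_sqr_invf_le (k : nat) : k%:R * (k`!)%:R ^- 2 <= (k`!)%:R^-1 :> R.
Proof.
have k0 : 0 < (k`!)%:R :> R by rewrite ltr0n fact_gt0.
rewrite expr2 invfM mulrA ler_piMl ?invr_ge0 ?(ltW k0)//.
by rewrite ler_pdivrMr// mul1r ler_nat; exact: fact_geq.
Qed.

Lemma coefRe_fact k t : `|coefRe k t| <= 1 / (k`!)%:R.
Proof. by rewrite div1r; exact: le_trans (coefRe_le k t) (sqr_invf_le k). Qed.

Lemma coefIm_fact k t : `|coefIm k t| <= Num.min 1 `|t| / (k`!)%:R.
Proof.
rewrite /Num.min; case: ifPn => _.
  by rewrite div1r; exact: le_trans (coefIm_le1 k t) (sqr_invf_le k).
by apply: (le_trans (coefIm_let k t)); rewrite ler_wpM2l ?natM_sqr_invf_le.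
Qed.

Lemma diffs_coefRe_fact k t :
  `|pseries_diffs (coefRe ^~ t) k| <= 1 / (k`!)%:R.
Proof. exact: (fact_bound_diffs (coefRe_fact ^~ t)). Qed.

Lemma diffs_coefIm_fact k t :
  `|pseries_diffs (coefIm ^~ t) k| <= Num.min 1 `|t| / (k`!)%:R.
Proof. exact: (fact_bound_diffs (coefIm_fact ^~ t)). Qed.

Lemma continuous_coef k : continuous (coefRe k : R -> R) /\ continuous (coefIm k : R -> R).
Proof.
elim: k => [|k [IHr IHi]].
  split; [rewrite (_ : coefRe 0 = cst 1) | rewrite (_ : coefIm 0 = cst 0)];
    by [exact: cst_continuous | apply/funext => t; rewrite ?coefRe0 ?coefIm0].
have cD t : {for t, continuous (fun t : R => (k.+1%:R * (k.+1%:R ^+ 2 + t ^+ 2))^-1)}.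
  apply: continuousV.
    by rewrite gt_eqF// mulr_gt0// ltr_pwDl ?sqr_ge0 ?exprn_gt0.
  apply: continuousM; first exact: cst_continuous.
  by apply: continuousD; [exact: cst_continuous | exact: exprn_continuous].
split=> t.
  rewrite (_ : coefRe k.+1 = fun t => - (coefRe k t * k.+1%:R + coefIm k t * t) /
    (k.+1%:R * (k.+1%:R ^+ 2 + t ^+ 2))).
    apply: (@continuousM _ _ (fun t => - (coefRe k t * k.+1%:R + coefIm k t * t))
      _ t _ (cD t)).
    apply: continuousN; apply: continuousD.
      by apply: continuousM; [exact: IHr | exact: cst_continuous].
    by apply: continuousM => //; exact: IHi.
  by apply/funext => z; rewrite coefReS.
rewrite (_ : coefIm k.+1 = fun t => (coefRe k t * t - coefIm k t * k.+1%:R) /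
  (k.+1%:R * (k.+1%:R ^+ 2 + t ^+ 2))).
  apply: (@continuousM _ _ (fun t => coefRe k t * t - coefIm k t * k.+1%:R) _ t _ (cD t)).
  apply: continuousB.
    by apply: continuousM => //; exact: IHr.
  by apply: continuousM; [exact: IHi | exact: cst_continuous].
by apply/funext => z; rewrite coefImS.
Qed.

Definition psRe t s : R := ps (coefRe ^~ t) s.
Definition psIm t s : R := ps (coefIm ^~ t) s.
Definition psRe' t s : R := ps (pseries_diffs (coefRe ^~ t)) s.
Definition psIm' t s : R := ps (pseries_diffs (coefIm ^~ t)) s.
Definition psRe'' t s : R := ps (pseries_diffs (pseries_diffs (coefRe ^~ t))) s.
Definition psIm'' t s : R := ps (pseries_diffs (pseries_diffs (coefIm ^~ t))) s.

Lemma cvg_psRe t s : pseries (coefRe ^~ t) s @ \oo --> psRe t s.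
Proof. exact: (cvg_pseries (s := s) (coefRe_fact ^~ t)). Qed.

Lemma cvg_psIm t s : pseries (coefIm ^~ t) s @ \oo --> psIm t s.
Proof. exact: (cvg_pseries (s := s) (coefIm_fact ^~ t)). Qed.

Lemma cvg_psRe' t s :
  pseries (pseries_diffs (coefRe ^~ t)) s @ \oo --> psRe' t s.
Proof. exact: (cvg_pseries (s := s) (diffs_coefRe_fact ^~ t)). Qed.

Lemma cvg_psIm' t s :
  pseries (pseries_diffs (coefIm ^~ t)) s @ \oo --> psIm' t s.
Proof. exact: (cvg_pseries (s := s) (diffs_coefIm_fact ^~ t)). Qed.

(** Real part of s f'' + (1 + it) f' + f = 0 for f = psRe + i psIm. It is the recurrence of the
    coefficients, summed: i (i + 1) + (i + 1) = (i + 1)^2. *)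
Lemma ps_odeRe t s : s * psRe'' t s + psRe' t s - t * psIm' t s = - psRe t s.
Proof.
have h1 := cvg_mul_pseries_diffs (s := s) (diffs_coefRe_fact ^~ t).
have h := cvgB (cvgD h1 (@cvg_psRe' t s)) (cvgM (cvg_cst (t : R)) (@cvg_psIm' t s)).
have h4 := cvgN (@cvg_psRe t s).
rewrite -[RHS](cvg_lim _ (h4 _))// -[LHS](cvg_lim _ (h _ _ _ _))//; congr (limn _).
apply/funext => n; rewrite !fctE /pseries /series /= -sumrN mulr_sumr -big_split/=.
rewrite -sumrB; apply: eq_bigr => i _; rewrite -[in RHS]mulNr -coef_recRe /pseries_diffs.
by rewrite -[i.+1%:R]natr1; ring.
Qed.

Lemma ps_odeIm t s : s * psIm'' t s + psIm' t s + t * psRe' t s = - psIm t s.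
Proof.
have h1 := cvg_mul_pseries_diffs (s := s) (diffs_coefIm_fact ^~ t).
have h := cvgD (cvgD h1 (@cvg_psIm' t s)) (cvgM (cvg_cst (t : R)) (@cvg_psRe' t s)).
have h4 := cvgN (@cvg_psIm t s).
rewrite -[RHS](cvg_lim _ (h4 _))// -[LHS](cvg_lim _ (h _ _ _ _))//; congr (limn _).
apply/funext => n; rewrite !fctE /pseries /series /= -sumrN mulr_sumr -big_split/=.
rewrite -big_split; apply: eq_bigr => i _; rewrite -[in RHS]mulNr -coef_recIm /pseries_diffs.
by rewrite -[i.+1%:R]natr1 /=; ring.
Qed.

(** By [rGammaE] every term of the series contains 1 / Gamma(1 + it), and (y / 2)^(it) is common as
    well; what remains is a power series in (y / 2)^2. *)
Lemma besselJE t y : 0 < y -> besselJ (0 +i* t) y =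
  rGamma1 t * cexp (0 +i* (t * ln (y / 2))) *
    (psRe t ((y / 2) ^+ 2) +i* psIm t ((y / 2) ^+ 2)).
Proof.
move=> y0; set s := (y / 2) ^+ 2; apply: climn_eq.
have y20 : 0 < y / 2 by rewrite divr_gt0.
set K := rGamma1 t * _.
have E n : series (fun k : nat => (-1) ^+ k / (k`!)%:R *
      rGamma (0 +i* t + k%:R + 1) * cpow (y / 2%:R) (0 +i* t + (2 * k)%:R)) n =
    K * (pseries (coefRe ^~ t) s n +i* pseries (coefIm ^~ t) s n).
  have -> : pseries (coefRe ^~ t) s n +i* pseries (coefIm ^~ t) s n =
      \sum_(0 <= k < n) bessel_coef t k * (s ^+ k)%:C.
    rewrite /pseries /series /=; elim: n => [|n IHn]; first by rewrite !big_geq.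
    rewrite !big_nat_recr//= -IHn; apply/eqP; rewrite eq_complex /= /coefRe /coefIm.
    by case: (bessel_coef t n) => a b /=; rewrite !mulr0 subr0 add0r !eqxx.
  rewrite /series /= mulr_sumr; apply: eq_bigr => k _.
  have -> : cpow (y / 2) (0 +i* t + (2 * k)%:R) =
      cexp (0 +i* (t * ln (y / 2))) * (s ^+ k)%:C.
    rewrite /cpow mulrDr cexpD; congr (cexp _ * _).
      by apply/eqP; rewrite eq_complex /=; apply/andP; split; apply/eqP; ring.
    rewrite natc -rmorphM cexp_real /s -exprM mulrC expRM_natl lnK ?posrE//.
  by rewrite rGammaE /bessel_coef /K; ring.
apply: (@eq_ccvgn _ (fun n => K * (pseries (coefRe ^~ t) s n +i* pseries (coefIm ^~ t) s n))).
  by apply: nearW => n; rewrite -E.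
apply: ccvgnM; first exact: ccvgn_cst.
by split; [exact: cvg_psRe | exact: cvg_psIm].
Qed.

End BesselCoefficients.

(** * Bessel's equation and the bound on Im J *)

Section Wave.
Context {R : realType}.
Implicit Types (t u s : R).

(* For w'' = - (4 exp (2 x) + t ^ 2) w, the energy
   w ^ 2 + w' ^ 2 / (4 exp (2 x) + t ^ 2) is nonincreasing. *)
Lemma energy_le (w v : R -> R) t u :
  (forall x : R, is_derive x 1 w (v x)) ->
  (forall x : R, is_derive x 1 v (- (4 * expR (2 * x) + t ^+ 2) * w x)) ->
  0 <= u -> w u ^+ 2 <= w 0 ^+ 2 + v 0 ^+ 2 / (4 + t ^+ 2).
Proof.
move=> dw dv u0.
pose E (x : R) := 4 * expR (2 * x) + t ^+ 2.
have E0 x : 0 < E x by rewrite ltr_pwDl ?sqr_ge0// mulr_gt0// expR_gt0.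
have dE (x : R) : is_derive x 1 E (8 * expR (2 * x)).
  have h : is_derive x 1 (fun x => expR (2 * x)) (expR (2 * x) * 2).
    apply: (@is_derive_compf _ (@expR R) (fun x => 2 * x)).
    by apply: is_derive_eq; rewrite /GRing.scale /= mulr1.
  apply: is_derive_eq (is_deriveDf (is_deriveZf 4 h) (is_derive_cst (t ^+ 2) x 1)) _.
  by ring.
have dV (x : R) : is_derive x 1 (fun x => - (w x * w x + v x * v x * (E x)^-1))
    (8 * expR (2 * x) * (v x / E x) ^+ 2).
  have h1 := is_deriveMf (dw x) (dw x).
  have h2 := is_deriveMf (is_deriveMf (dv x) (dv x)) (is_deriveVf (lt0r_neq0 (E0 x)) (dE x)).
  apply: is_derive_eq (is_deriveN (is_deriveDf h1 h2)) _.
  rewrite -/(E x); have := lt0r_neq0 (E0 x); move: (E x) => e e0.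
  by field.
have := @ge0_derive_le _ _ _ _ _ u0 (fun z _ => dV z).
have E00 : E 0 = 4 + t ^+ 2 by rewrite /E mulr0 expR0 mulr1.
rewrite /= lerN2 E00 -!expr2 => h.
have {}h : w u ^+ 2 + v u ^+ 2 / E u <= w 0 ^+ 2 + v 0 ^+ 2 / (4 + t ^+ 2).
  apply: h => z _; apply: mulr_ge0; last exact: sqr_ge0.
  by rewrite mulr_ge0// expR_ge0.
apply: le_trans h; rewrite lerDl divr_ge0 ?sqr_ge0//; exact: ltW.
Qed.

(* Real and imaginary parts of Gamma(1 + it) J_(it)(2 exp u). *)
Definition waveRe t u : R :=
  cos (t * u) * psRe t (expR (2 * u)) - sin (t * u) * psIm t (expR (2 * u)).
Definition waveIm t u : R :=
  sin (t * u) * psRe t (expR (2 * u)) + cos (t * u) * psIm t (expR (2 * u)).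

(** [veloc1 + i veloc2] is e^(- itu) w', for w = [waveRe + i waveIm] = e^(itu) f(e^(2 u)) and f =
    [psRe + i psIm]. *)
Definition veloc1 t u : R :=
  2 * expR (2 * u) * psRe' t (expR (2 * u)) - t * psIm t (expR (2 * u)).
Definition veloc2 t u : R :=
  2 * expR (2 * u) * psIm' t (expR (2 * u)) + t * psRe t (expR (2 * u)).

Lemma is_derive_exp2 u : is_derive u 1 (fun x => expR (2 * x)) (2 * expR (2 * u)).
Proof.
rewrite mulrC; apply: (@is_derive_compf _ (@expR R) (fun x => 2 * x)).
by apply: is_derive_eq; rewrite /GRing.scale /= mulr1.
Qed.

Lemma is_derive_psRe t u : is_derive u 1 (fun x => psRe t (expR (2 * x)))
  (veloc1 t u + t * psIm t (expR (2 * u))).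
Proof.
have h := is_derive_ps (expR (2 * u)) (coefRe_fact ^~ t).
apply: is_derive_eq
  (@is_derive_compf _ (psRe t) (fun x => expR (2 * x)) _ _ _ h (is_derive_exp2 u)) _.
by rewrite /veloc1 -/(psRe' _ _); ring.
Qed.

Lemma is_derive_psIm t u : is_derive u 1 (fun x => psIm t (expR (2 * x)))
  (veloc2 t u - t * psRe t (expR (2 * u))).
Proof.
have h := is_derive_ps (expR (2 * u)) (coefIm_fact ^~ t).
apply: is_derive_eq
  (@is_derive_compf _ (psIm t) (fun x => expR (2 * x)) _ _ _ h (is_derive_exp2 u)) _.
by rewrite /veloc2 -/(psIm' _ _); ring.
Qed.

Lemma is_derive_psRe' t u : is_derive u 1 (fun x => psRe' t (expR (2 * x)))
  (2 * expR (2 * u) * psRe'' t (expR (2 * u))).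
Proof.
have h := is_derive_ps (expR (2 * u)) (diffs_coefRe_fact ^~ t).
by apply: is_derive_eq
  (@is_derive_compf _ (psRe' t) (fun x => expR (2 * x)) _ _ _ h (is_derive_exp2 u)) _; rewrite mulrC.
Qed.

Lemma is_derive_psIm' t u : is_derive u 1 (fun x => psIm' t (expR (2 * x)))
  (2 * expR (2 * u) * psIm'' t (expR (2 * u))).
Proof.
have h := is_derive_ps (expR (2 * u)) (diffs_coefIm_fact ^~ t).
by apply: is_derive_eq
  (@is_derive_compf _ (psIm' t) (fun x => expR (2 * x)) _ _ _ h (is_derive_exp2 u)) _; rewrite mulrC.
Qed.

Lemma is_derive_veloc1 t u : is_derive u 1 (veloc1 t)
  (t * veloc2 t u - (4 * expR (2 * u) + t ^+ 2) * psRe t (expR (2 * u))).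
Proof.
have h1 := is_deriveMf (is_deriveZf 2 (is_derive_exp2 u)) (is_derive_psRe' t u).
have h2 := is_deriveZf t (is_derive_psIm t u).
apply: is_derive_eq (is_deriveBf h1 h2) _.
rewrite /veloc2; set s := expR _.
have := ps_odeRe t s => /(congr1 (fun x => - x)); rewrite opprK => <-.
by ring.
Qed.

Lemma is_derive_veloc2 t u : is_derive u 1 (veloc2 t)
  (- t * veloc1 t u - (4 * expR (2 * u) + t ^+ 2) * psIm t (expR (2 * u))).
Proof.
have h1 := is_deriveMf (is_deriveZf 2 (is_derive_exp2 u)) (is_derive_psIm' t u).
have h2 := is_deriveZf t (is_derive_psRe t u).
apply: is_derive_eq (is_deriveDf h1 h2) _.
rewrite /veloc1; set s := expR _.
have := ps_odeIm t s => /(congr1 (fun x => - x)); rewrite opprK => <-.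
by ring.
Qed.

Lemma is_derive_cosM t u : is_derive u 1 (fun x => cos (t * x)) (- t * sin (t * u)).
Proof.
have h : is_derive u 1 (fun x => t * x) t.
  by apply: is_derive_eq; rewrite /GRing.scale /= mulr1.
have := @is_derive_compf _ (@cos R) (fun x => t * x) _ _ _ (is_derive_cos _) h.
by move=> h'; apply: is_derive_eq h' _; ring.
Qed.

Lemma is_derive_sinM t u : is_derive u 1 (fun x => sin (t * x)) (t * cos (t * u)).
Proof.
have h : is_derive u 1 (fun x => t * x) t.
  by apply: is_derive_eq; rewrite /GRing.scale /= mulr1.
have := @is_derive_compf _ (@sin R) (fun x => t * x) _ _ _ (is_derive_sin _) h.
by move=> h'; apply: is_derive_eq h' _; ring.
Qed.

Definition waveRe' t u : R := cos (t * u) * veloc1 t u - sin (t * u) * veloc2 t u.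
Definition waveIm' t u : R := sin (t * u) * veloc1 t u + cos (t * u) * veloc2 t u.

Lemma is_derive_waveRe t u : is_derive u 1 (waveRe t) (waveRe' t u).
Proof.
have h := is_deriveBf (is_deriveMf (is_derive_cosM t u) (is_derive_psRe t u))
   (is_deriveMf (is_derive_sinM t u) (is_derive_psIm t u)).
by apply: is_derive_eq h _; rewrite /waveRe'; ring.
Qed.

Lemma is_derive_waveIm t u : is_derive u 1 (waveIm t) (waveIm' t u).
Proof.
have h := is_deriveDf (is_deriveMf (is_derive_sinM t u) (is_derive_psRe t u))
   (is_deriveMf (is_derive_cosM t u) (is_derive_psIm t u)).
by apply: is_derive_eq h _; rewrite /waveIm'; ring.
Qed.

Lemma is_derive_waveRe' t u : is_derive u 1 (waveRe' t)
  (- (4 * expR (2 * u) + t ^+ 2) * waveRe t u).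
Proof.
have h := is_deriveBf (is_deriveMf (is_derive_cosM t u) (is_derive_veloc1 t u))
   (is_deriveMf (is_derive_sinM t u) (is_derive_veloc2 t u)).
by apply: is_derive_eq h _; rewrite /waveRe; ring.
Qed.

Lemma is_derive_waveIm' t u : is_derive u 1 (waveIm' t)
  (- (4 * expR (2 * u) + t ^+ 2) * waveIm t u).
Proof.
have h := is_deriveDf (is_deriveMf (is_derive_sinM t u) (is_derive_veloc1 t u))
   (is_deriveMf (is_derive_cosM t u) (is_derive_veloc2 t u)).
by apply: is_derive_eq h _; rewrite /waveIm; ring.
Qed.

Let e : R := expR 1.
Let cap t : R := Num.min 1 `|t|.

Lemma cap_ge0 t : 0 <= cap t.
Proof. by rewrite /cap le_min ler01 normr_ge0. Qed.

Lemma cap_le1 t : cap t <= 1.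
Proof. by rewrite /cap ge_min lexx. Qed.

Lemma cap_le t : cap t <= `|t|.
Proof. by rewrite /cap ge_min lexx orbT. Qed.

Lemma ps_bounds t s : 0 <= s <= 1 ->
  [/\ `|psRe t s| <= e, `|psIm t s| <= e * cap t, `|psRe' t s| <= e &
      `|psIm' t s| <= e * cap t].
Proof.
move=> /andP[s0 s1]; have es : expR `|s| <= e by rewrite ler_expR ger0_norm.
have h C c : 0 <= C -> (forall i, `|c i| <= C / i`!%:R) -> `|ps c s| <= e * C.
  move=> C0 hc; apply: (le_trans (ps_norm_le s hc)).
  by rewrite mulrC ler_wpM2r.
split; first by rewrite -[e]mulr1; apply: h => // i; exact: coefRe_fact.
- by apply: h => [|i]; [exact: cap_ge0 | exact: coefIm_fact].
- by rewrite -[e]mulr1; apply: h => // i; exact: diffs_coefRe_fact.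
- by apply: h => [|i]; [exact: cap_ge0 | exact: diffs_coefIm_fact].
Qed.

Lemma sqr_le_norm (x c : R) : 0 <= c -> `|x| <= c -> x ^+ 2 <= c ^+ 2.
Proof. by move=> c0 xc; rewrite -real_normK ?num_real// lerXn2r. Qed.

Lemma norm_le_sqr (x c : R) : 0 <= c -> x ^+ 2 <= c ^+ 2 -> `|x| <= c.
Proof.
by move=> c0 xc; rewrite -ler_sqr ?nnegrE// real_normK ?num_real.
Qed.

(** The equation has real coefficients, so the energy inequality applies to [waveRe] and [waveIm]
    separately, and the second keeps its small initial data. The data at u = 0 are power series at s
    = 1. *)
Lemma wave_pos_le t u : 0 <= u ->
  `|waveRe t u| <= 2 * e /\ `|waveIm t u| <= 2 * e * cap t.
Proof.
move=> u0; have e0 : 0 < e by exact: expR_gt0.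
have [hA hB hA' hB'] := @ps_bounds t 1 (introT andP (conj ler01 (lexx 1))).
have d0 := cap_ge0 t; have d1 := cap_le1 t; have dt := cap_le t.
have D0 : 0 < 4 + t ^+ 2 by rewrite ltr_pwDl ?sqr_ge0.
have t2 : `|t| ^+ 2 = t ^+ 2 by rewrite real_normK ?num_real.
have v1 : veloc1 t 0 ^+ 2 <= (e * (2 + `|t|)) ^+ 2.
  apply: sqr_le_norm; first by rewrite mulr_ge0 ?addr_ge0// ltW.
  rewrite /veloc1 mulr0 expR0 mulr1; apply: (le_trans (ler_normB _ _)).
  rewrite !normrM (ger0_norm (_ : 0 <= 2))//.
  have : `|t| * `|psIm t 1| <= `|t| * (e * 1).
    by rewrite ler_wpM2l//; apply: (le_trans hB); rewrite ler_wpM2l// ltW.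
  by move: hA'; lra.
have v2 : veloc2 t 0 ^+ 2 <= (e * (2 * cap t + `|t|)) ^+ 2.
  apply: sqr_le_norm; first by rewrite mulr_ge0 ?addr_ge0 ?mulr_ge0// ltW.
  rewrite /veloc2 mulr0 expR0 mulr1; apply: (le_trans (ler_normD _ _)).
  rewrite !normrM (ger0_norm (_ : 0 <= 2))//.
  have : `|t| * `|psRe t 1| <= `|t| * e by rewrite ler_wpM2l.
  by move: hB'; lra.
split.
  apply: norm_le_sqr; first by rewrite mulr_ge0// ltW.
  apply: (le_trans (energy_le (is_derive_waveRe t) (is_derive_waveRe' t) u0)).
  rewrite /waveRe /waveRe' !mulr0 cos0 sin0 expR0 !mul1r !mul0r !subr0.
  have hA2 : psRe t 1 ^+ 2 <= e ^+ 2 by apply: sqr_le_norm => //; exact: ltW.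
  have h : veloc1 t 0 ^+ 2 / (4 + t ^+ 2) <= 2 * e ^+ 2.
    rewrite ler_pdivrMr//; apply: (le_trans v1).
    have -> : 2 * e ^+ 2 * (4 + t ^+ 2) = e ^+ 2 * (2 * (4 + t ^+ 2)) by ring.
    rewrite exprMn ler_wpM2l ?sqr_ge0// -t2.
    by have := sqr_ge0 (`|t| - 2); nra.
  by move: (sqr_ge0 e); rewrite exprMn; lra.
apply: norm_le_sqr; first by rewrite !mulr_ge0// ltW.
apply: (le_trans (energy_le (is_derive_waveIm t) (is_derive_waveIm' t) u0)).
rewrite /waveIm /waveIm' !mulr0 cos0 sin0 expR0 !mul1r !mul0r !add0r.
have hB2 : psIm t 1 ^+ 2 <= (e * cap t) ^+ 2.
  by apply: sqr_le_norm => //; rewrite mulr_ge0// ltW.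
(* The term t psRe of the velocity has size |t| and not min(1, |t|). For |t| > 1 the t^2 in the
   denominator makes up for it; for |t| <= 1 the two sizes agree. *)
have h : veloc2 t 0 ^+ 2 / (4 + t ^+ 2) <= 3 * (e * cap t) ^+ 2.
  rewrite ler_pdivrMr//; apply: (le_trans v2).
  have -> : 3 * (e * cap t) ^+ 2 * (4 + t ^+ 2) = e ^+ 2 * (3 * cap t ^+ 2 * (4 + t ^+ 2)) by ring.
  rewrite exprMn ler_wpM2l ?sqr_ge0// -t2.
  rewrite /cap /Num.min; case: ltP => ht.
    by have := sqr_ge0 (`|t| - 2); nra.
  by have := normr_ge0 t; nra.
have := sqr_ge0 (e * cap t).
have -> : (2 * e * cap t) ^+ 2 = 4 * (e * cap t) ^+ 2 by ring.
by lra.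
Qed.

Lemma norm_sin_le (x : R) : `|sin x| <= `|x|.
Proof.
have h (y : R) : 0 <= y -> sin y <= y /\ - sin y <= y.
  move=> y0; have d1 (z : R) : is_derive z 1 (fun z : R => z - sin z) (1 - cos z).
    exact: is_deriveBf.
  have d2 (z : R) : is_derive z 1 (fun z : R => z + sin z) (1 + cos z).
    exact: is_deriveDf.
  have := @ge0_derive_le _ _ _ _ _ y0 (fun z _ => d1 z).
  have := @ge0_derive_le _ _ _ _ _ y0 (fun z _ => d2 z).
  rewrite sin0 subr0 addr0 => h1 h2; split.
    by rewrite -subr_ge0; apply: h2 => z _; rewrite subr_ge0 cos_le1.
  rewrite -subr_ge0 opprK; apply: h1 => z _.
  by have := cos_geN1 z; lra.
have [x0|/ltW x0] := leP 0 x; rewrite ler_norml.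
  by have [] := h x x0; rewrite ger0_norm//; lra.
have [] := h (- x); first by rewrite oppr_ge0.
by rewrite sinN ler0_norm//; lra.
Qed.

(** For u <= 0 the ascending series applies, since s = e^(2 u) <= 1. In [waveIm] the term sin (t u)
    psRe is small in t only through |sin (t u)| <= |t| |u|; this is the origin of the factor 1 - u,
    a logarithmic singularity in y. *)
Lemma wave_le t u :
  `|waveRe t u| <= 2 * e /\ `|waveIm t u| <= 2 * e * cap t * (1 + Num.max 0 (- u)).
Proof.
have e0 : 0 < e by exact: expR_gt0.
have d0 := cap_ge0 t; have d1 := cap_le1 t.
have [u0|/ltW u0] := leP 0 u.
  have [h1 h2] := wave_pos_le t u0; split=> //.
  apply: (le_trans h2); rewrite ler_peMr ?mulr_ge0//; first exact: ltW.
  by rewrite lerDl le_max lexx.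
have s1 : 0 <= expR (2 * u) <= 1 by rewrite expR_ge0 expR_le1; lra.
have [hA hB _ _] := ps_bounds t s1.
have -> : Num.max 0 (- u) = - u by apply/max_idPr; rewrite oppr_ge0.
have c1 := cos_max (t * u).
have sd : `|sin (t * u)| <= cap t * (1 - u).
  rewrite /cap /Num.min; case: ltP => ht.
    by apply: (le_trans (sin_max _)); rewrite mul1r; lra.
  apply: (le_trans (norm_sin_le _)); rewrite normrM ler_wpM2l// ler0_norm//; lra.
have s11 := sin_max (t * u).
have hB' : `|psIm t (expR (2 * u))| <= e by apply: (le_trans hB); rewrite ler_piMr// ltW.
have pM (a b c d : R) : `|a| <= c -> `|b| <= d -> `|a * b| <= c * d.
  by move=> ac bd; rewrite normrM; exact: ler_pM.
split.
  apply: (le_trans (ler_normB _ _)).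
  by have := pM _ _ _ _ c1 hA; have := pM _ _ _ _ s11 hB'; lra.
apply: (le_trans (ler_normD _ _)).
have h1 := pM _ _ _ _ sd hA; have h2 := pM _ _ _ _ c1 hB.
have h3 : e * cap t <= e * cap t * (1 - u) by rewrite ler_peMr ?mulr_ge0//; [exact: ltW | lra].
by lra.
Qed.

(* Im J_(it)(2 exp u). *)
Definition imJ t u : R := expR (log_modulus t) *
  (cos (argument t) * waveIm t u + sin (argument t) * waveRe t u).

Lemma Im_besselJE t y : 0 < y ->
  complex.Im (besselJ (0 +i* t) y) = imJ t (ln (y / 2)).
Proof.
move=> y0; rewrite besselJE//.
have -> : (y / 2) ^+ 2 = expR (2 * ln (y / 2)).
  by rewrite expRM_natl lnK// posrE divr_gt0.
rewrite /imJ /waveIm /waveRe /rGamma1 /cexp /= expR0.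
by ring.
Qed.

(** For t >= 0 write sinh x = e^x (1 - e^(- 2 x)) / 2 with 2 x = pi t, and use 1 - e^(- z) >= z / (1
    + z) >= min(1, t) / 2 for z = pi t >= t. The bound records both the simple zero and the growth
    of sinh. *)
Lemma norm_sinh_ge t : cap t * expR (pi * `|t| / 2) / 4 <= `|sinh (pi * t / 2)|.
Proof.
wlog t0 : t / 0 <= t.
  move=> h; have [/h//|/ltW] := leP 0 t.
  rewrite -oppr_ge0 => /h; rewrite /cap normrN mulrN mulNr.
  have -> : sinh (- (pi * t / 2)) = - sinh (pi * t / 2).
    by rewrite /sinh opprK; ring.
  by rewrite normrN.
rewrite (ger0_norm t0) /sinh.
have pt : t <= pi * t by rewrite ler_peMl// (le_trans _ (pi_ge2 R))//; lra.
have z0 : 0 <= pi * t by rewrite mulr_ge0// pi_ge0.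
set x := pi * t / 2.
have -> : (expR x - expR (- x)) / 2 = expR x * (1 - expR (- (pi * t))) / 2.
  by rewrite mulrBr mulr1 -expRD; congr ((_ - expR _) / 2); rewrite /x; field.
have h : expR (- (pi * t)) <= (1 + pi * t)^-1.
  by rewrite expRN lef_pV2 ?posrE ?expR_gt0 ?ltr_pwDl// expR_ge1Dx.
have h2 : cap t / 2 <= 1 - (1 + pi * t)^-1.
  have -> : 1 - (1 + pi * t)^-1 = pi * t / (1 + pi * t).
    move: z0; move: (pi * t) => z z0.
    by field; rewrite lt0r_neq0 ?ltr_pwDl.
  rewrite ler_pdivlMr ?ltr_pwDl// mulrAC ler_pdivrMr//.
  have := cap_le1 t; have := cap_le t; rewrite ger0_norm// => h3 h4.
  have := cap_ge0 t; move: (cap t) (pi * t) h3 h4 pt z0 => d z h3 h4 pt z0 d0.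
  by nra.
have h3 : 0 <= 1 - expR (- (pi * t)) by rewrite subr_ge0 expR_le1 oppr_le0.
rewrite ger0_norm ?divr_ge0 ?mulr_ge0 ?expR_ge0//.
have := expR_ge0 x; move: h h2; move: (expR x) (expR _) (_^-1) (cap t) => E f g d h h2 E0.
by nra.
Qed.

(** In the numerator each product has one factor of order min(1, |t|), namely [waveIm] or sin
    (argument t), and e^(log_modulus t) <= e^(pi |t| / 2). Both cancel against [norm_sinh_ge]. *)
Lemma imJ_le : exists2 C : R, 0 <= C & forall t u, t != 0 ->
  `|imJ t u / sinh (pi * t / 2)| <= C * (1 + Num.max 0 (- u)).
Proof.
have [C C0 hC] := @argument_le R.
have e0 : 0 < e by exact: expR_gt0.
(* The summand 2 C serves |t| <= 1, where t^2 + |t| <= 2 |t|; the summand 1 serves |t| > 1, where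
   |sin| <= 1. *)
pose C1 := 1 + 2 * C; have C10 : 0 <= C1 by rewrite /C1; lra.
exists (4 * (2 * e + 2 * e * C1)) => [|t u t0].
  by rewrite mulr_ge0// addr_ge0// ?mulr_ge0// ltW.
have d0 : 0 < cap t by rewrite /cap lt_min ltr01 normr_gt0.
have sn : `|sin (argument t)| <= C1 * cap t.
  rewrite /cap /Num.min; case: ltP => ht.
    by apply: (le_trans (sin_max _)); rewrite /C1; lra.
  apply: (le_trans (norm_sin_le _)); apply: (le_trans (hC t)).
  have : t ^+ 2 <= `|t| by rewrite -real_normK ?num_real// expr2 ler_piMl.
  by have := normr_ge0 t; rewrite /C1; nra.
have [hP hQ] := wave_le t u.
set m := 1 + _ in hQ *.
have m1 : 1 <= m by rewrite /m lerDl le_max lexx.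
have pM (a b c d : R) : `|a| <= c -> `|b| <= d -> `|a * b| <= c * d.
  by move=> ac bd; rewrite normrM; exact: ler_pM.
have h1 := pM _ _ _ _ (cos_max (argument t)) hQ.
have h2 := pM _ _ _ _ sn hP.
set G := expR (pi * `|t| / 2); have G0 : 0 < G by exact: expR_gt0.
have hL : `|expR (log_modulus t)| <= G.
  by rewrite ger0_norm ?expR_ge0// ler_expR; exact: log_modulus_le.
have hJ : `|imJ t u| <= G * ((2 * e + 2 * e * C1) * (cap t * m)).
  rewrite /imJ; apply: pM => //; apply: (le_trans (ler_normD _ _)).
  apply: (le_trans (lerD h1 h2)).
  have : C1 * cap t * (2 * e) <= C1 * cap t * (2 * e) * m.
    by rewrite ler_peMr// !mulr_ge0// ltW.
  by lra.
have hs := norm_sinh_ge t; rewrite -/G in hs.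
have s0 : 0 < `|sinh (pi * t / 2)|.
  by apply: lt_le_trans hs; rewrite !mulr_gt0// invr_gt0.
rewrite normrM normfV ler_pdivrMr//; apply: (le_trans hJ).
have K0 : 0 <= 4 * (2 * e + 2 * e * C1) * m.
  rewrite !mulr_ge0//; last by apply: le_trans m1.
  by rewrite addr_ge0// ?mulr_ge0// ltW.
apply: le_trans (ler_wpM2l K0 hs).
by rewrite le_eqVlt; apply/orP; left; apply/eqP; field.
Qed.

Lemma continuous_imJ_time t : continuous (imJ t).
Proof.
move=> u; apply: (is_derive_continuous (a := expR (log_modulus t) *
  (cos (argument t) * waveIm' t u + sin (argument t) * waveRe' t u))).
apply: is_deriveZf; apply: is_deriveDf; apply: is_deriveZf.
  exact: is_derive_waveIm.
exact: is_derive_waveRe.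
Qed.

Lemma continuous_imJ_order u : continuous (imJ ^~ u).
Proof.
move=> t; have ctu : {for t, continuous (fun t : R => t * u)}.
  by apply: continuousM => //; exact: cst_continuous.
have cps (c : nat -> R -> R) s : (forall k, continuous (c k)) ->
    (forall k z, `|c k z| <= 1 / (k`!)%:R) ->
    {for t, continuous (fun z : R => ps (c ^~ z) s)}.
  move=> cc cb; apply: (@continuous_ps _ _ 1) => [|k]; last exact: cc.
  by near=> z => k; exact: cb.
have cA : {for t, continuous (psRe ^~ (expR (2 * u)))}.
  by apply: cps => [k|k z]; [exact: (continuous_coef k).1 | exact: coefRe_fact].
have cB : {for t, continuous (psIm ^~ (expR (2 * u)))}.
  apply: cps => [k|k z]; first exact: (continuous_coef k).2.
  by rewrite div1r; exact: le_trans (coefIm_le1 k z) (sqr_invf_le k).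
have comp (f g : R -> R) : continuous f -> {for t, continuous g} ->
    {for t, continuous (fun z : R => f (g z))}.
  by move=> cf cg; apply: continuous_comp => //; exact: cf.
have cM (f g : R -> R) : {for t, continuous f} -> {for t, continuous g} ->
    {for t, continuous (fun z : R => f z * g z)}.
  by move=> cf cg; exact: (continuousM cf cg).
have cD (f g : R -> R) : {for t, continuous f} -> {for t, continuous g} ->
    {for t, continuous (fun z : R => f z + g z)}.
  by move=> cf cg; exact: (continuousD cf cg).
have cB' (f g : R -> R) : {for t, continuous f} -> {for t, continuous g} ->
    {for t, continuous (fun z : R => f z - g z)}.
  by move=> cf cg; exact: (continuousB cf cg).
have cc : {for t, continuous (fun z : R => cos (z * u))}.
  exact: (comp (@cos R) _ (@continuous_cos R)).
have cs : {for t, continuous (fun z : R => sin (z * u))}.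
  exact: (comp (@sin R) _ (@continuous_sin R)).
apply: (cM (fun z : R => expR (log_modulus z)) (fun z : R => cos (argument z) * waveIm z u +
  sin (argument z) * waveRe z u)).
  exact: (comp (@expR R) _ (@continuous_expR R) (@continuous_log_modulus R t)).
apply: (cD (fun z : R => cos (argument z) * waveIm z u)
  (fun z : R => sin (argument z) * waveRe z u)).
  apply: (cM (fun z : R => cos (argument z)) (waveIm ^~ u)).
    exact: (comp (@cos R) _ (@continuous_cos R) (@continuous_argument R t)).
  by apply: (cD (fun z : R => sin (z * u) * _) (fun z : R => cos (z * u) * _)); exact: cM.
apply: (cM (fun z : R => sin (argument z)) (waveRe ^~ u)).
  exact: (comp (@sin R) _ (@continuous_sin R) (@continuous_argument R t)).
by apply: (cB' (fun z : R => cos (z * u) * _) (fun z : R => sin (z * u) * _)); exact: cM.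
Unshelve. all: by end_near. Qed.

End Wave.

(** * The Macdonald function *)

Section Macdonald.
Context {R : realType}.
Implicit Types (t y u m : R).
Notation leb := (@lebesgue_measure R).

Definition macK t y : R :=
  (\int[leb]_(u in `[0%R, +oo[) (expR (- y * cosh u) * cos (t * u)))%R.

(** The inequality y / m <= e^(y / m), raised to the power m. *)
Lemma expRN_le_powR m y : 0 < m -> 0 < y -> expR (- y) <= m `^ m * y `^ (- m).
Proof.
move=> m0 y0; rewrite expRN powRN -[X in X <= _]mul1r ler_pdivlMr ?powR_gt0//.
rewrite mul1r mulrC ler_pdivrMr ?expR_gt0//.
rewrite -[in y `^ m](divfK (lt0r_neq0 m0) y) mulrC powRM ?(ltW m0)//; last first.
  by rewrite divr_ge0// ltW.
rewrite ler_wpM2l ?powR_ge0//.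
have yE : expR y = expR (y / m) `^ m by rewrite -expRM divfK// lt0r_neq0.
rewrite yE; apply: ge0_ler_powR; rewrite ?nnegrE ?expR_ge0 ?divr_ge0 ?(ltW m0) ?(ltW y0)//.
by apply: le_trans (expR_ge1Dx _); rewrite lerDr.
Qed.

Lemma cosh_ge u : expR u / 2 <= cosh u.
Proof. by rewrite /cosh ler_wpM2r// lerDl expR_ge0. Qed.

(** From cosh u >= e^u / 2, the power gained in y comes with the rate e^(- m u) in u: a single
    estimate yields both integrability in u and decay in y. *)
Lemma expR_cosh_le m y u : 0 < m -> 0 < y ->
  expR (- y * cosh u) <= (m `^ m * 2 `^ m * y `^ (- m)) * expR (- m * u).
Proof.
move=> m0 y0; have yu : 0 < y * (expR u / 2) by rewrite mulr_gt0 ?divr_gt0 ?expR_gt0.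
apply: (@le_trans _ _ (expR (- (y * (expR u / 2))))).
  by rewrite ler_expR mulNr lerN2 ler_wpM2l ?cosh_ge// ltW.
apply: (le_trans (expRN_le_powR m0 yu)).
rewrite powRM ?(ltW y0) ?divr_ge0 ?expR_ge0// powRM ?expR_ge0//.
rewrite -powR_inv1// -powRrM mulN1r opprK -[expR u `^ _]expRM.
rewrite le_eqVlt; apply/orP; left; apply/eqP.
by rewrite [u * - m]mulrC; ring.
Qed.

Lemma is_derive_expRM (m u : R) : is_derive u 1 (fun u => expR (m * u)) (m * expR (m * u)).
Proof.
rewrite mulrC; apply: (@is_derive_compf _ (@expR R) (fun u => m * u)).
by apply: is_derive_eq; rewrite /GRing.scale /= mulr1.
Qed.

Lemma continuous_expRM m : continuous (fun u : R => expR (m * u)).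
Proof. by move=> u; exact: is_derive_continuous (is_derive_expRM m u). Qed.

Lemma is_derive_primitive m u : m != 0 ->
  is_derive u 1 (fun u => - (expR (- m * u) / m)) (expR (- m * u)).
Proof.
move=> m0; rewrite (_ : (fun _ => _) = fun u => - m^-1 * expR (- m * u)).
  apply: is_derive_eq (is_deriveZf _ (is_derive_expRM (- m) u)) _.
  by rewrite mulrA mulrNN mulVf// mul1r.
by apply/funext => z; ring.
Qed.

Lemma integral_expRNM m : 0 < m ->
  (\int[leb]_(u in `[0%R, +oo[) (expR (- m * u))%:E = (m^-1)%:E)%E.
Proof.
move=> m0; have mN0 := lt0r_neq0 m0.
rewrite (@ge0_continuous_FTC2y _ _ (fun u => - (expR (- m * u) / m)) _ 0)//.
- by rewrite mulr0 expR0 div1r -EFinB opprK add0r.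
- by apply: continuous_subspaceT; exact: continuous_expRM.
- have -> : (0 : R) = - (0 * m^-1) by rewrite mul0r oppr0.
  apply: cvgN; apply: cvgM; last exact: cvg_cst.
  rewrite (_ : (fun x => expR (- m * x)) = (fun z => expR (- z)) \o (fun z => m * z)).
    by apply: (@cvg_comp _ _ _ _ _ _ (pinfty_nbhs R)); [exact: gt0_cvgMry | exact: cvgr_expR].
  by apply/funext => x /=; rewrite mulNr.
- apply: cvg_at_right_filter.
  exact: is_derive_continuous (is_derive_primitive 0 mN0).
- by move=> u _; rewrite derive1E; have [_ ->] := is_derive_primitive u mN0.
Qed.

Lemma integrable_expRNM m : 0 < m ->
  leb.-integrable `[0%R, +oo[ (EFin \o fun u => expR (- m * u)).
Proof.
move=> m0; apply/integrableP; split.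
  apply/measurable_EFinP; apply: measurable_funTS.
  by apply: continuous_measurable_fun; exact: continuous_expRM.
under eq_integral do rewrite /= ger0_norm ?expR_ge0//.
by rewrite integral_expRNM// ltry.
Qed.

Lemma is_derive_cosh u : is_derive u 1 (@cosh R) (sinh u).
Proof.
have h1 := is_derive_expRM 1 u; have h2 := is_derive_expRM (-1) u.
have h := is_deriveMf (is_deriveDf h1 h2) (is_derive_cst (2^-1 : R) u 1).
rewrite (_ : cosh = fun u => (expR (1 * u) + expR (-1 * u)) * cst 2^-1 u).
  by apply: is_derive_eq h _; rewrite /sinh /cst !mul1r !mulN1r; ring.
by apply/funext => z; rewrite /cosh mul1r mulN1r.
Qed.

Lemma is_derive_exp_cosh y u : is_derive u 1 (fun u => expR (- y * cosh u))
  (- y * sinh u * expR (- y * cosh u)).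
Proof.
have h := is_deriveZf (- y) (is_derive_cosh u).
have := @is_derive_compf _ (@expR R) (fun u => - y * cosh u) _ _ _ (is_derive_expR _) h.
by move=> h'; apply: is_derive_eq h' _; rewrite mulrC.
Qed.

Lemma is_derive_integrand y t u :
  is_derive u 1 (fun u => expR (- y * cosh u) * cos (t * u))
  (- y * sinh u * expR (- y * cosh u) * cos (t * u) +
   expR (- y * cosh u) * (- t * sin (t * u))).
Proof. exact: is_deriveMf (is_derive_exp_cosh y u) (is_derive_cosM t u). Qed.

Lemma continuous_integrand y t :
  continuous (fun u : R => expR (- y * cosh u) * cos (t * u)).
Proof. by move=> u; exact: is_derive_continuous (is_derive_integrand y t u). Qed.

Lemma norm_integrand_le y t u :
  `|expR (- y * cosh u) * cos (t * u)| <= expR (- y * cosh u).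
Proof. by rewrite normrM ger0_norm ?expR_ge0// ler_piMr ?expR_ge0// cos_max. Qed.

Lemma measurable_EFin_continuous (f : R -> R) (D : set R) :
  continuous f -> measurable_fun D (EFin \o f).
Proof.
move=> cf; apply/measurable_EFinP; apply: measurable_funTS.
exact: continuous_measurable_fun.
Qed.

Lemma integrable_exp_cosh y : 0 < y ->
  leb.-integrable `[0%R, +oo[ (EFin \o fun u => expR (- y * cosh u)).
Proof.
(* The constant of [expR_cosh_le] at m = 1, left unreduced so that it matches. *)
move=> y0; pose C : R := 1 `^ 1 * 2 `^ 1 * y `^ (- 1).
have h : leb.-integrable `[0%R, +oo[ (fun u => C%:E * (expR (-1 * u))%:E)%E.
  by apply: integrableZl => //; exact: integrable_expRNM.
apply: le_integrable h => //.
  apply: measurable_EFin_continuous => u.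
  exact: is_derive_continuous (is_derive_exp_cosh y u).
move=> u _; rewrite /= lee_fin ger0_norm ?expR_ge0//.
apply: le_trans (ler_norm _); exact: expR_cosh_le.
Qed.

Lemma integrable_integrand y t : 0 < y ->
  leb.-integrable `[0%R, +oo[ (EFin \o fun u => expR (- y * cosh u) * cos (t * u)).
Proof.
move=> y0; apply: le_integrable (integrable_exp_cosh y0) => //.
  by apply: measurable_EFin_continuous; exact: continuous_integrand.
move=> u _; rewrite /= lee_fin [leRHS]ger0_norm ?expR_ge0//.
exact: norm_integrand_le.
Qed.

(** cosh (itu) = cos (tu), so K_(it)(y) is real. *)
Lemma besselKE t y : 0 < y -> besselK (0 +i* t) y = (macK t y)%:C.
Proof.
move=> y0; rewrite /besselK /cintegral.
have E u : (expR (- y * cosh u))%:C * ccosh ((0 +i* t) * u%:C) =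
    (expR (- y * cosh u) * cos (t * u))%:C.
  rewrite /ccosh; have -> : (0 +i* t) * u%:C = 0 +i* (t * u).
    by apply/eqP; rewrite eq_complex /=; apply/andP; split; apply/eqP; ring.
  have -> : cexp (0 +i* (t * u)) + cexp (- (0 +i* (t * u))) = 2%:R * (cos (t * u))%:C.
    rewrite natc; apply/eqP; rewrite eq_complex /= oppr0 expR0 cosN sinN.
    by apply/andP; split; apply/eqP; ring.
  by rewrite [2%:R * _]mulrC mulfK ?pnatr_eq0// rmorphM.
under eq_Rintegral do rewrite E Re_real.
under [X in _ +i* X]eq_Rintegral do rewrite E Im_real.
apply/eqP; rewrite eq_complex /=; apply/andP; split; apply/eqP.
  rewrite /macK Rintegral_itv_obnd_cbnd//.
  apply: integrableS (integrable_integrand t y0) => // x /=.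
  by rewrite !in_itv/= !andbT; exact: ltW.
by rewrite /Rintegral integral0_eq.
Qed.

Lemma macK_le m t y : 0 < m -> 0 < y ->
  `|macK t y| <= m `^ m * 2 `^ m / m * y `^ (- m).
Proof.
move=> m0 y0; apply: (le_trans (le_normr_Rintegral _ (integrable_integrand t y0))) => //.
set C := m `^ m * 2 `^ m * y `^ (- m).
have iC : leb.-integrable `[0%R, +oo[ (EFin \o fun u => C * expR (- m * u)).
  have : leb.-integrable `[0%R, +oo[ (fun u => C%:E * (expR (- m * u))%:E)%E.
    by apply: integrableZl => //; exact: integrable_expRNM.
  by apply: eq_integrable.
have -> : m `^ m * 2 `^ m / m * y `^ (- m) =
    (\int[leb]_(u in `[0%R, +oo[) (C * expR (- m * u)))%R.
  rewrite RintegralZl//; last exact: integrable_expRNM.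
  by rewrite /Rintegral integral_expRNM//= /C; ring.
apply: le_Rintegral => //.
  exact: integrable_norm (integrable_integrand t y0).
move=> u _; apply: (le_trans (norm_integrand_le y t u)); exact: expR_cosh_le.
Qed.

End Macdonald.

(** * Decay of K_(it) in the order, and continuity *)

Section MacdonaldDecay.
Context {R : realType}.
Implicit Types (t y u m : R).
Notation leb := (@lebesgue_measure R).

Lemma continuous_integrable_itv (f : R -> R) (a b : R) : continuous f ->
  leb.-integrable `[a, b] (EFin \o f).
Proof.
move=> cf; apply: continuous_compact_integrable; first exact: segment_compact.
exact: continuous_subspaceT.
Qed.

Lemma Rintegral_derive (f F : R -> R) (a b : R) : a < b -> continuous f ->
  (forall u, is_derive u 1 F (f u)) ->
  (\int[leb]_(u in `[a, b]) f u)%R = F b - F a.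
Proof.
move=> ab cf dF; rewrite /Rintegral (@continuous_FTC2 _ f F)//.
- exact: continuous_subspaceT.
- split.
  + by move=> x _; have [] := dF x.
  + exact: cvg_at_right_filter (is_derive_continuous (dF a)).
  + exact: cvg_at_left_filter (is_derive_continuous (dF b)).
- by move=> x _; rewrite derive1E; have [_ ->] := dF x.
Qed.

Lemma sinh_ge0 u : 0 <= u -> 0 <= sinh u.
Proof.
by move=> u0; rewrite /sinh divr_ge0// subr_ge0 ler_expR; lra.
Qed.

Lemma cosh0 : cosh 0 = 1 :> R.
Proof. by rewrite /cosh oppr0 expR0; lra. Qed.

Lemma continuous_sinh : continuous (@sinh R).
Proof.
move=> u; have h1 := is_derive_expRM 1 u; have h2 := is_derive_expRM (-1) u.
have h := is_deriveMf (is_deriveBf h1 h2) (is_derive_cst (2^-1 : R) u 1).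
rewrite (_ : sinh = fun u => (expR (1 * u) - expR (-1 * u)) * cst 2^-1 u).
  exact: is_derive_continuous h.
by apply/funext => z; rewrite /sinh mul1r mulN1r.
Qed.

(* Integration by parts: the integrand is at most the derivative of
   (c sin (t u) - 1) exp (- y cosh u) / t. *)
Lemma oscillatory_integral_le (c t y A : R) : `|c| <= 1 -> 0 < t -> 0 < y -> 0 < A ->
  (\int[leb]_(u in `[0%R, A]) (c * (expR (- y * cosh u) * cos (t * u))))%R <=
  expR (- y) / t.
Proof.
move=> c1 t0 y0 A0.
pose F u := (c * sin (t * u) - 1) * t^-1 * expR (- y * cosh u).
pose f u := c * (expR (- y * cosh u) * cos (t * u)) +
  y * sinh u * expR (- y * cosh u) * ((1 - c * sin (t * u)) * t^-1).
have dF u : is_derive u 1 F (f u).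
  have h1 := is_deriveBf (is_deriveZf c (is_derive_sinM t u)) (is_derive_cst (1 : R) u 1).
  have h2 := is_deriveMf (is_deriveMf h1 (is_derive_cst (t^-1 : R) u 1)) (is_derive_exp_cosh y u).
  apply: is_derive_eq h2 _; rewrite /cst /f.
  by field; rewrite lt0r_neq0.
have csin : continuous (fun u : R => c * sin (t * u)).
  by move=> u; exact: is_derive_continuous (is_deriveZf c (is_derive_sinM t u)).
have cexp : continuous (fun u : R => expR (- y * cosh u)).
  by move=> u; exact: is_derive_continuous (is_derive_exp_cosh y u).
have c0 : continuous (fun u : R => c * (expR (- y * cosh u) * cos (t * u))).
  apply: (@continuousMf _ (fun=> c) (fun u => expR (- y * cosh u) * cos (t * u))).
    exact: continuous_cst.
  exact: continuous_integrand.
have cf : continuous f.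
  apply: (continuousDf c0); apply: (@continuousMf _
    (fun u => y * sinh u * expR (- y * cosh u)) (fun u => (1 - c * sin (t * u)) * t^-1)).
    apply: (@continuousMf _ (fun u => y * sinh u)) => //.
    by apply: (@continuousMf _ (fun=> y)); [exact: continuous_cst | exact: continuous_sinh].
  apply: (@continuousMf _ (fun u => 1 - c * sin (t * u)) (fun=> t^-1)).
    by apply: (@continuousBf _ (fun=> 1)) => //; exact: continuous_cst.
  exact: continuous_cst.
have sin1 u : c * sin (t * u) <= 1.
  apply: (le_trans (ler_norm _)); rewrite normrM -[leRHS]mulr1.
  by apply: ler_pM => //; exact: sin_max.
apply: (@le_trans _ _ (\int[leb]_(u in `[0%R, A]) f u)%R).
  apply: le_Rintegral => //; try exact: continuous_integrable_itv.
  move=> u /=; rewrite in_itv/= => /andP[u0 _].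
  rewrite /f lerDl; apply: mulr_ge0.
    apply: mulr_ge0; last exact: expR_ge0.
    by apply: mulr_ge0; [exact: ltW | exact: sinh_ge0].
  by rewrite mulr_ge0 ?subr_ge0 ?invr_ge0 ?(ltW t0).
rewrite (Rintegral_derive A0 cf dF) /F mulr0 sin0 mulr0 cosh0 mulr1 sub0r.
have h : 0 <= (1 - c * sin (t * A)) * t^-1 * expR (- y * cosh A).
  by rewrite !mulr_ge0 ?expR_ge0 ?subr_ge0 ?invr_ge0 ?(ltW t0).
by move: h; lra.
Qed.

(** The bound of [oscillatory_integral_le] does not depend on the cut-off A, and the tail beyond A
    is arbitrarily small. Taking c = 1 and c = -1 gives the two sides of the absolute value. *)
Lemma macK_decay_pos t y : 0 < t -> 0 < y -> `|macK t y| <= expR (- y) / t.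
Proof.
move=> t0 y0.
pose C : R := 1 `^ 1 * 2 `^ 1 * y `^ (- 1).
have C0 : 0 < C by rewrite /C !mulr_gt0// powR_gt0.
have iK c : leb.-integrable `[0%R, +oo[
    (EFin \o fun u => c * (expR (- y * cosh u) * cos (t * u))).
  have : leb.-integrable `[0%R, +oo[
      (fun u => c%:E * (expR (- y * cosh u) * cos (t * u))%:E)%E.
    by apply: integrableZl => //; exact: integrable_integrand.
  by apply: eq_integrable.
have iC : leb.-integrable `[0%R, +oo[ (EFin \o fun u => C * expR (- 1 * u)).
  have : leb.-integrable `[0%R, +oo[ (fun u => C%:E * (expR (- 1 * u))%:E)%E.
    by apply: integrableZl => //; exact: integrable_expRNM.
  by apply: eq_integrable.
have tailC A : 0 < A -> (\int[leb]_(u in `]A, +oo[) (C * expR (- 1 * u)))%R = C * expR (- A).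
  move=> A0; rewrite -(Rintegral_itvB iC)//; last by rewrite bnd_simp ltW.
  rewrite RintegralZl//; last exact: integrable_expRNM.
  rewrite /Rintegral integral_expRNM//= -/(Rintegral _ _ _).
  have dF (u : R) : is_derive u 1 (fun u => - (C * expR (-1 * u))) (C * expR (- 1 * u)).
    apply: is_derive_eq (is_deriveN (is_deriveZf C (is_derive_expRM (-1) u))) _.
    by ring.
  have cf : continuous (fun u => C * expR (- 1 * u)).
    by move=> u; apply: (is_derive_continuous (is_deriveZf C (is_derive_expRM (-1) u))).
  rewrite (Rintegral_derive A0 cf dF).
  by rewrite mulr0 expR0 mulN1r invr1; lra.
have key c : `|c| <= 1 -> c * macK t y <= expR (- y) / t.
  move=> c1; apply/ler_addgt0Pr => eps eps0.
  (* At the cut-off A = C / eps the tail is at most C e^(- A) <= C / A = eps. *)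
  have A0 : 0 < C / eps by rewrite divr_gt0.
  rewrite /macK -RintegralZl//; last exact: integrable_integrand.
  have tail : (\int[leb]_(u in `](C / eps)%R, +oo[)
      (c * (expR (- y * cosh u) * cos (t * u))))%R <= eps.
    apply: (@le_trans _ _ (C * expR (- (C / eps)))).
      rewrite -tailC//; apply: le_Rintegral => //.
      - apply: integrableS (iK c) => // u /=.
        by rewrite !in_itv/= !andbT => /ltW; apply: le_trans; exact: ltW.
      - apply: integrableS iC => // u /=.
        by rewrite !in_itv/= !andbT => /ltW; apply: le_trans; exact: ltW.
      move=> u _; apply: (le_trans (ler_norm _)); rewrite normrM.
      rewrite -[leRHS]mul1r; apply: ler_pM => //.
      apply: (le_trans (norm_integrand_le _ _ _)); exact: expR_cosh_le.
    rewrite expRN ler_pdivrMr ?expR_gt0// -ler_pdivrMl// mulrC.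
    by apply: le_trans (expR_ge1Dx _); rewrite lerDr.
  have := Rintegral_itvB (iK c)
    (_ : (BLeft 0 <= BRight (C / eps))%O) (_ : (BRight (C / eps) <= +oo)%O).
  move=> /(_ (ltW A0) isT)/eqP; rewrite subr_eq => /eqP ->.
  by rewrite addrC lerD// oscillatory_integral_le.
rewrite ler_norml; have := key 1; have := key (-1).
by rewrite normrN normr1 => /(_ (lexx _)) h1 /(_ (lexx _)) h2; lra.
Qed.

Lemma macKN t y : macK (- t) y = macK t y.
Proof. by rewrite /macK; under eq_Rintegral do rewrite [- t * _]mulNr cosN. Qed.

Lemma macK_decay t y : t != 0 -> 0 < y -> `|macK t y| <= expR (- y) / `|t|.
Proof.
move=> t0 y0; have [tp|tn] := ltP 0 t.
  by rewrite [`|t|]gtr0_norm//; exact: macK_decay_pos.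
have tN : 0 < - t by rewrite oppr_gt0 lt_neqAle t0.
by rewrite -macKN (ler0_norm tn); exact: macK_decay_pos.
Qed.

(** The factor 1 + |t| is split: the absolute bound on the integral serves 1, the integration by
    parts serves |t|. *)
Lemma macK_bound m : 0 < m -> exists2 C : R, 0 <= C &
  forall t y, 0 < y -> `|macK t y| <= C * y `^ (- m) / (1 + `|t|).
Proof.
move=> m0; pose C1 : R := m `^ m * 2 `^ m / m; pose C2 : R := m `^ m.
have C10 : 0 <= C1 by rewrite /C1 !mulr_ge0 ?powR_ge0 ?invr_ge0// ltW.
exists (C1 + C2) => [|t y y0]; first by rewrite addr_ge0// powR_ge0.
have t1 : 0 < 1 + `|t| by rewrite ltr_pwDl.
rewrite ler_pdivlMr// mulrDr mulr1 mulrDl; apply: lerD; first exact: macK_le.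
have [->|t0] := eqVneq t 0; first by rewrite normr0 mulr0 mulr_ge0 ?powR_ge0.
rewrite -ler_pdivlMr ?normr_gt0//; apply: (le_trans (macK_decay t0 y0)).
by rewrite ler_wpM2r ?invr_ge0//; exact: expRN_le_powR.
Qed.

Lemma continuous_macK_order y : 0 < y -> continuous (macK ^~ y).
Proof.
move=> y0 t.
apply: (@continuity_under_integral R _ _ leb (fun t u => expR (- y * cosh u) * cos (t * u))
  `[0%R, +oo[ _ (t - 1) (t + 1) _ _ (fun u => expR (- y * cosh u))) => //.
- by move=> z _; exact: integrable_integrand.
- apply: aeW => u _ z _; apply: (@continuousMf _ (fun=> expR (- y * cosh u)) (fun z => cos (z * u))).
    exact: continuous_cst.
  move=> w; apply: (@continuous_comp _ _ _ (fun z : R => z * u) (@cos R)).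
    by apply: (@continuousMf _ id (fun=> u)); [move=> v; exact: cvg_id | exact: continuous_cst].
  exact: continuous_cos.
- exact: integrable_exp_cosh.
- by move=> z _; apply: aeW => u _; exact: norm_integrand_le.
by rewrite inE/= in_itv/=; lra.
Qed.

Lemma continuous_macK_arg t y : 0 < y -> {for y, continuous (macK t)}.
Proof.
move=> y0.
(* On (y / 2, y + 1) the integrand is dominated by the exponential at y / 2, which keeps the
   argument away from 0. *)
apply: (@continuity_under_integral R _ _ leb (fun y u => expR (- y * cosh u) * cos (t * u))
  `[0%R, +oo[ _ (y / 2) (y + 1) _ _ (fun u => expR (- (y / 2) * cosh u))) => //.
- move=> z /=; rewrite in_itv/= => /andP[z0 _]; apply: integrable_integrand; lra.
- apply: aeW => u _ z _; apply: (@continuousMf _ (fun z => expR (- z * cosh u)) (fun=> cos (t * u))).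
    rewrite (_ : (fun _ => _) = fun z => expR ((- cosh u) * z)).
      exact: continuous_expRM.
    by apply/funext => w; rewrite mulrC mulrN mulNr.
  exact: continuous_cst.
- by apply: integrable_exp_cosh; lra.
- move=> z /=; rewrite in_itv/= => /andP[z0 _]; apply: aeW => u _.
  apply: (le_trans (norm_integrand_le _ _ _)).
  rewrite ler_expR ler_wpM2r; [by [] | |lra].
  by apply: le_trans (cosh_ge u); rewrite divr_ge0 ?expR_ge0.
by rewrite inE/= in_itv/=; lra.
Qed.

End MacdonaldDecay.

(** * The kernel as a real function *)

Section RealKernel.
Context {R : realType}.
Implicit Types (t x m : R).

Definition psi t x : R := macK t (2 * Num.sqrt (2 * x)) *
  imJ t (ln (2 * x) / 2) / sinh (pi * t / 2).

Lemma ln_sqrt x : 0 < x -> ln (Num.sqrt x) = ln x / 2.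
Proof. by move=> x0; rewrite -powR12_sqrt ?ltW// ln_powR mulrC. Qed.

Lemma PsiE t x : 0 < x -> Psi t x = (psi t x)%:C.
Proof.
move=> x0; have y0 : 0 < 2 * Num.sqrt (2 * x) by rewrite mulr_gt0// sqrtr_gt0 mulr_gt0.
rewrite /Psi besselKE// Im_besselJE// [2 * Num.sqrt _]mulrC mulfK ?pnatr_eq0//.
rewrite ln_sqrt ?mulr_gt0// /psi [2 * Num.sqrt _]mulrC.
have E (a b c : R) : a%:C * b%:C / c%:C = (a * b / c)%:C.
  by rewrite fmorph_div rmorphM.
exact: E.
Qed.

(** Here x / 0 = 0 is the convention; it lets the bound on the kernel hold at every t. *)
Lemma psi0 x : psi 0 x = 0.
Proof.
have s0 : sinh (pi * 0 / 2) = 0 :> R by rewrite /sinh mulr0 mul0r oppr0 subrr mul0r.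
by rewrite /psi s0 invr0 mulr0.
Qed.

(** The inequality ln z <= z at z = x^(- m). *)
Lemma ln_powR_bound m x : 0 < m -> 0 < x ->
  1 + Num.max 0 (- (ln x / 2)) <= 1 + x `^ (- m) / (2 * m).
Proof.
move=> m0 x0; rewrite lerD2l ge_max divr_ge0 ?powR_ge0 ?mulr_ge0 ?(ltW m0)//=.
have h : ln (x `^ (- m)) <= x `^ (- m).
  by apply: ltW; apply: ln_sublinear; exact: powR_gt0.
rewrite ln_powR in h; rewrite ler_pdivlMr ?mulr_gt0//.
by apply: le_trans h; rewrite le_eqVlt; apply/orP; left; apply/eqP; field.
Qed.

(** With z = 2 x and y = 2 sqrt z, the factor from [imJ_le] is at most a constant times 1 + z^(- m /
    2) / m. Against the summand 1, K is bounded by a multiple of y^(- 2 m) <= z^(- m); against the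
    other, by a multiple of y^(- m) <= z^(- m / 2). Both products are then of order z^(- m). *)
Lemma psi_bound m : 0 < m -> exists2 C : R, 0 <= C &
  forall t x, 0 < x -> `|psi t x| <= C * x `^ (- m) / (1 + `|t|).
Proof.
move=> m0; have m20 : 0 < 2 * m by rewrite mulr_gt0.
have mh0 : 0 < m / 2 by rewrite divr_gt0.
have [C1 C10 hC1] := @macK_bound R _ m20.
have [C2 C20 hC2] := @macK_bound R _ m0.
have [C3 C30 hC3] := @imJ_le R.
exists (C3 * (C1 + C2 / m)) => [|t x x0].
  by rewrite mulr_ge0 ?addr_ge0 ?divr_ge0 ?(ltW m0).
have t1 : 0 < 1 + `|t| by rewrite ltr_pwDl.
have [->|t0] := eqVneq t 0.
  by rewrite psi0 normr0 !mulr_ge0 ?addr_ge0 ?mulr_ge0 ?invr_ge0 ?powR_ge0 ?(ltW m0) ?addr_ge0.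
set z := 2 * x; have z0 : 0 < z by rewrite mulr_gt0.
set y := 2 * Num.sqrt z; have y0 : 0 < y by rewrite mulr_gt0// sqrtr_gt0.
have p2 k : 0 < k -> 1 <= 2 `^ k :> R.
  by move=> k0; have := ler_powR (ler1n R 2) (ltW k0); rewrite powRr0.
have yz k : 0 < k -> y `^ (- k) <= z `^ (- (k / 2)).
  move=> k0; rewrite /y powRM// ?sqrtr_ge0// -(powR12_sqrt (ltW z0)) -powRrM.
  rewrite mulrN [2^-1 * k]mulrC ler_piMl ?powR_ge0// powRN invf_le1 ?powR_gt0//.
  exact: p2.
have zx : z `^ (- m) <= x `^ (- m).
  rewrite /z powRM ?(ltW x0)// ler_piMl ?powR_ge0// powRN invf_le1 ?powR_gt0//.
  exact: p2.
have hK1 : `|macK t y| <= C1 * z `^ (- m) / (1 + `|t|).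
  apply: (le_trans (hC1 t y y0)); rewrite ler_wpM2r ?invr_ge0 ?(ltW t1)// ler_wpM2l//.
  by apply: (le_trans (yz _ m20)); rewrite [2 * m]mulrC mulfK.
have hK2 : `|macK t y| <= C2 * z `^ (- (m / 2)) / (1 + `|t|).
  apply: (le_trans (hC2 t y y0)); rewrite ler_wpM2r ?invr_ge0 ?(ltW t1)// ler_wpM2l//.
  exact: yz.
have hJ := hC3 t (ln z / 2) t0.
have hl := ln_powR_bound mh0 z0; rewrite [2 * (m / 2)]mulrC divfK// in hl.
rewrite /psi -/z -/y -mulrA normrM.
apply: (@le_trans _ _ (`|macK t y| * (C3 * (1 + z `^ (- (m / 2)) / m)))).
  by rewrite ler_wpM2l//; apply: (le_trans hJ); rewrite ler_wpM2l.
have zz : z `^ (- (m / 2)) * z `^ (- (m / 2)) = z `^ (- m).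
  rewrite -powRD; first by congr (_ `^ _); field.
  by rewrite (gt_eqF z0) implybT.
apply: (@le_trans _ _ (C3 * (C1 + C2 / m) * z `^ (- m) / (1 + `|t|))); last first.
  rewrite ler_wpM2r ?invr_ge0 ?(ltW t1)// ler_wpM2l//.
  by rewrite mulr_ge0 ?addr_ge0 ?divr_ge0 ?(ltW m0).
rewrite mulrCA -!mulrA ler_wpM2l// mulrDr mulr1 !mulrA mulrDl mulrDl.
apply: lerD => //.
have -> : C2 / m * z `^ (- m) / (1 + `|t|) =
    C2 * z `^ (- (m / 2)) / (1 + `|t|) * (z `^ (- (m / 2)) / m).
  by rewrite -zz; ring.
by rewrite -mulrA ler_wpM2r// divr_ge0 ?powR_ge0 ?(ltW m0).
Qed.

Lemma continuous_psi_arg t x : 0 < x -> {for x, continuous (psi t)}.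
Proof.
move=> x0.
have cl : {for x, continuous (fun x : R => 2 * x)}.
  by apply: (@continuousMf _ (fun=> 2) id) => // v; [exact: cst_continuous | exact: cvg_id].
have z0 : 0 < 2 * x by rewrite mulr_gt0.
have c1 : {for x, continuous (fun x => macK t (2 * Num.sqrt (2 * x)))}.
  apply: (@continuous_comp _ _ _ (fun x : R => 2 * Num.sqrt (2 * x)) (macK t)).
    apply: continuousM; first exact: cst_continuous.
    apply: (@continuous_comp _ _ _ (fun x : R => 2 * x) Num.sqrt) => //.
    exact: sqrt_continuous.
  by apply: continuous_macK_arg; rewrite mulr_gt0// sqrtr_gt0.
have c2 : {for x, continuous (fun x => imJ t (ln (2 * x) / 2))}.
  apply: (@continuous_comp _ _ _ (fun x : R => ln (2 * x) / 2) (imJ t)).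
    apply: continuousM; last exact: cst_continuous.
    apply: (@continuous_comp _ _ _ (fun x : R => 2 * x) (@ln R)) => //.
    exact: continuous_ln.
  exact: continuous_imJ_time.
have c3 : {for x, continuous (fun _ : R => (sinh (pi * t / 2))^-1)}.
  exact: cst_continuous.
exact: (continuousM (continuousM c1 c2) c3).
Qed.

Lemma measurable_psi t : measurable_fun (`]0%R, +oo[ : set R) (psi t).
Proof.
apply: open_continuous_measurable_fun => // x.
by rewrite inE/= in_itv/= andbT; exact: continuous_psi_arg.
Qed.

Lemma sinh_neq0 t : t != 0 -> sinh t != 0.
Proof.
move=> t0; rewrite /sinh mulf_neq0 ?invr_neq0 ?subr_eq0//.
by apply/eqP => /expR_inj h; move/eqP: t0; apply; lra.
Qed.

Lemma continuous_psi_order t x : t != 0 -> 0 < x -> {for t, continuous (psi ^~ x)}.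
Proof.
move=> t0 x0.
have c1 : {for t, continuous (fun t => macK t (2 * Num.sqrt (2 * x)))}.
  by apply: continuous_macK_order; rewrite mulr_gt0// sqrtr_gt0 mulr_gt0.
have c2 : {for t, continuous (fun t => imJ t (ln (2 * x) / 2))}.
  exact: continuous_imJ_order.
have c3 : {for t, continuous (fun t : R => (sinh (pi * t / 2))^-1)}.
  apply: continuousV; first by rewrite sinh_neq0// !mulf_neq0// ?invr_neq0// gt_eqF// pi_gt0.
  apply: (@continuous_comp _ _ _ (fun t : R => pi * t / 2) (@sinh R)).
    apply: (@continuousMf _ (fun t => pi * t) (fun=> 2^-1)); last exact: continuous_cst.
    by apply: (@continuousMf _ (fun=> pi) id) => // v; [exact: cst_continuous | exact: cvg_id].
  exact: continuous_sinh.
exact: (continuousM (continuousM c1 c2) c3).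
Qed.

End RealKernel.

(** * Pointwise extraction *)

Section PointwiseExtraction.
Context {R : realType} {T : Type}.

(** By compactness of [- B, B] the image of [U] has a cluster point. If some neighbourhood of it had
    a preimage outside the ultrafilter, the complement of that preimage would belong to it, against
    clustering. *)
Lemma ultra_bounded_cvg (U : set_system nat) (u : nat -> R) (B : R) :
  UltraFilter U -> (forall n, `|u n| <= B) ->
  exists l : R, forall e, 0 < e -> U [set n | `|u n - l| < e].
Proof.
move=> UU uB; have UP : ProperFilter U by exact: ultra_proper.
have cB : compact (`[- B, B] : set R) by exact: segment_compact.
have [l [_ cl]] : (`[- B, B] : set R) `&` cluster (u @ U) !=set0.
  apply: cB; rewrite /nbhs /=; apply: filterE => n.
  by rewrite /= in_itv/= -ler_norml.
exists l => e e0; have [//|UC] := in_ultra_setVsetC [set n | `|u n - l| < e] UU.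
have [z [/= zu zl]] := cl [set z | ~ `|z - l| < e] (ball l e) UC (nbhsx_ballx l _ e0).
by move: zl; rewrite /ball /= distrC => /zu.
Qed.

(* The limit along an ultrafilter is a cluster point at every t at once, so a
   subsequence can be chosen along the sample d without a diagonal argument. *)
Lemma pointwise_extraction (w : nat -> T -> R) (B : T -> R) (d : nat -> T) :
  (forall n t, `|w n t| <= B t) ->
  (forall t e, 0 < e -> exists j, forall n, `|w n (d j) - w n t| <= e) ->
  exists (phi : nat -> nat) (L : T -> R), {homo phi : m n / (m < n)%N} /\
    forall t, w (phi n) t @[n --> \oo] --> L t.
Proof.
move=> wB wd.
have [U [UU ooU]] := @ultraFilterLemma nat \oo _.
have UP : ProperFilter U by exact: ultra_proper.
have [L hL] : {L : T -> R & forall t e, 0 < e -> U [set n | `|w n t - L t| < e]}.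
  apply: (@choice T R (fun t l => forall e, 0 < e -> U [set n | `|w n t - l| < e])) => t.
  exact: (ultra_bounded_cvg (u := fun n => w n t) (B := B t)).
have near_d k : U [set n | forall j, (j < k)%N -> `|w n (d j) - L (d j)| < k.+1%:R^-1].
  have k0 : 0 < k.+1%:R^-1 :> R by rewrite invr_gt0.
  have h i : (i <= k)%N ->
      U [set n | forall j, (j < i)%N -> `|w n (d j) - L (d j)| < k.+1%:R^-1].
    elim: i => [_|i IHi ik]; first by apply: filterE.
    apply: filterS (filterI (IHi (ltnW ik)) (hL (d i) _ k0)) => n [/= h1 h2] j.
    by rewrite ltnS leq_eqVlt => /predU1P[->//|]; exact: h1.
  exact: h.
(* [f (k, m)] is an index beyond m at which the first k samples are close to their limits; [phi]
   iterates it. *)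
have [f hf] : {f : nat * nat -> nat & forall km, (km.2 < f km)%N /\
    forall j, (j < km.1)%N -> `|w (f km) (d j) - L (d j)| < km.1.+1%:R^-1}.
  apply: (@choice _ _ (fun km n => (km.2 < n)%N /\
    forall j, (j < km.1)%N -> `|w n (d j) - L (d j)| < km.1.+1%:R^-1)) => -[k m] /=.
  have Um : U [set n | (m < n)%N] by apply: ooU; exists m.+1.
  by have [n [/= mn hn]] := filter_ex (filterI Um (near_d k)); exists n.
pose phi := fix phi k := if k is k'.+1 then f (k'.+1, phi k') else f (0%N, 0%N).
have phi_d k j : (j < k)%N -> `|w (phi k) (d j) - L (d j)| < k.+1%:R^-1.
  by case: k => [//|k] jk; exact: (hf (k.+1, phi k)).2.
exists phi, L; split.
  by apply: homo_ltn => [y x z|i]; [exact: ltn_trans | exact: (hf (i.+1, phi i)).1].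
move=> t; apply/cvgrPdist_le => e e0.
(* Three fifths go to L (d j) against L t, one to the sample along [phi] against its limit, one to
   the sampling error. *)
have e40 : 0 < e / 5 by rewrite divr_gt0.
have [j hj] := wd t _ e40.
(* Both limits are taken along the same ultrafilter, so one index n is close to both. *)
have Ld : `|L (d j) - L t| <= 3 * (e / 5).
  have [n [/= h1 h2]] := filter_ex (filterI (hL t _ e40) (hL (d j) _ e40)).
  have h3 := hj n; move: h1 h2 h3; rewrite !ltr_norml !ler_norml; lra.
near=> n.
have jn : (j < n)%N by near: n; exists j.+1.
have h1 := phi_d n j jn; have h2 := hj (phi n).
have ne : n.+1%:R^-1 <= e / 5.
  near: n.
  have := @cvg_harmonic R; move/cvgrPdist_le => /(_ _ e40); apply: filterS => n.
  by rewrite /= sub0r normrN ger0_norm// invr_ge0.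
have {}h1 := lt_le_trans h1 ne.
by move: h1 h2 Ld; rewrite ltr_norml !ler_norml; lra.
Unshelve. all: by end_near. Qed.

End PointwiseExtraction.

(** * Integrable majorants on the line and on the half-line *)

Section Majorants.
Context {R : realType}.
Notation leb := (@lebesgue_measure R).

Lemma integrable_oneDsqrV : leb.-integrable setT (EFin \o fun t : R => (1 + t ^+ 2)^-1).
Proof.
have pos (t : R) : 0 < 1 + t ^+ 2 by rewrite ltr_pwDl ?sqr_ge0.
apply/integrableP; split.
  apply/measurable_EFinP; apply: continuous_measurable_fun.
  exact: continuous_oneDsqrV.
under eq_integral do rewrite /= ger0_norm ?invr_ge0 ?(ltW (pos _))//.
rewrite ge0_symfun_integralT.
- have := @integral0y_oneDsqr R; rewrite set_itvcy => ->.
  by rewrite -EFinM ltry.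
- by move=> t; rewrite invr_ge0 ltW.
- exact: continuous_oneDsqrV.
- by move=> t /=; rewrite sqrrN.
Qed.

(** The derivative of - 1 / (b (1 + x^b)): for b > 0, it behaves like x^(b - 1) at 0 and like x^(- b
    - 1) at infinity, and its integral is controlled by an explicit primitive. *)
Definition bump (b x : R) : R := x `^ (b - 1) / (1 + x `^ b) ^+ 2.

Lemma bump_ge0 b x : 0 <= bump b x.
Proof. by rewrite /bump divr_ge0 ?powR_ge0 ?sqr_ge0. Qed.

Lemma is_derive_bump (b x : R) : 0 < b -> 0 < x ->
  is_derive x 1 (fun x => - b^-1 * (1 + x `^ b)^-1) (bump b x).
Proof.
move=> b0 x0.
have D0 : 1 + x `^ b != 0 by rewrite lt0r_neq0// ltr_pwDl ?powR_ge0.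
have h := is_deriveDf (is_derive_cst (1 : R) x 1) (is_derive1_powR b x0).
have := is_deriveZf (- b^-1) (is_deriveVf (f := fun x => 1 + x `^ b) D0 h).
move=> h'; apply: is_derive_eq h' _; rewrite /bump.
move: D0; move: (1 + x `^ b) (x `^ (b - 1)) => D P D0.
by field; rewrite D0 lt0r_neq0.
Qed.

Lemma continuous_powR (a x : R) : 0 < x -> {for x, continuous (@powR R ^~ a)}.
Proof. by move=> x0; exact: is_derive_continuous (is_derive1_powR a x0). Qed.

Lemma continuous_bump (b x : R) : 0 < x -> {for x, continuous (bump b)}.
Proof.
move=> x0; have c1 := @continuous_powR (b - 1) x x0; have c2 := @continuous_powR b x x0.
have c3 : {for x, continuous (fun x => ((1 + x `^ b) ^+ 2)^-1)}.
  apply: continuousV; first by rewrite expf_neq0// lt0r_neq0// ltr_pwDl ?powR_ge0.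
  apply: (@continuous_comp _ _ _ (fun x => 1 + x `^ b) (fun z => z ^+ 2)).
    by apply: continuousD => //; exact: cst_continuous.
  exact: exprn_continuous.
exact: (continuousM c1 c3).
Qed.

Lemma integral_bump_itv_le (b u v : R) : 0 < b -> 0 < u -> u < v ->
  (\int[leb]_(x in `[u, v]) (bump b x)%:E <= (b^-1)%:E)%E.
Proof.
move=> b0 u0 uv.
have pos x : u <= x -> 0 < x by exact: lt_le_trans.
rewrite (@continuous_FTC2 _ _ (fun x => - b^-1 * (1 + x `^ b)^-1))//.
- rewrite lee_fin.
  have D x : 0 < 1 + x `^ b by rewrite ltr_pwDl ?powR_ge0.
  have h1 : 0 <= b^-1 * (1 + v `^ b)^-1 by rewrite mulr_ge0 ?invr_ge0 ?(ltW (D _))// ltW.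
  have h2 : b^-1 * (1 + u `^ b)^-1 <= b^-1.
    by rewrite ler_piMr ?invr_ge0 ?(ltW b0)// invf_le1// lerDl powR_ge0.
  by lra.
- apply: continuous_in_subspaceT => x; rewrite inE/= in_itv/= => /andP[ux _].
  by apply: continuous_bump; exact: pos.
- split.
  + move=> x; rewrite in_itv/= => /andP[ux _].
    by have [] := is_derive_bump b0 (pos _ (ltW ux)).
  + exact: cvg_at_right_filter (is_derive_continuous (is_derive_bump b0 u0)).
  + exact: cvg_at_left_filter (is_derive_continuous (is_derive_bump b0 (pos _ (ltW uv)))).
- move=> x; rewrite in_itv/= => /andP[ux _].
  by rewrite derive1E; have [_ ->] := is_derive_bump b0 (pos _ (ltW ux)).
Qed.

Lemma measurable_bump b : measurable_fun (`]0%R, +oo[ : set R) (bump b).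
Proof.
apply: open_continuous_measurable_fun => // x.
by rewrite inE/= in_itv/= andbT; exact: continuous_bump.
Qed.

Lemma integrable_bump b : 0 < b -> leb.-integrable `]0%R, +oo[ (EFin \o bump b).
Proof.
move=> b0.
have posn n : 0 < n.+1%:R^-1 :> R by rewrite invr_gt0.
(* An exhaustion for monotone convergence; the right endpoint n + 2 keeps the segment nondegenerate
   at n = 0. *)
pose E n : set R := `[n.+1%:R^-1, n.+2%:R]%classic.
have EU : \bigcup_n E n = `]0%R, +oo[%classic.
  apply/seteqP; split => [x [n _] /=|x /=]; rewrite !in_itv/= ?andbT.
    by move=> /andP[h _]; exact: lt_le_trans (posn n) h.
  move=> x0; near \oo => n; exists n => //; rewrite /E /= in_itv/=; apply/andP; split.
    near: n; have := @cvg_harmonic R; move/cvgrPdist_le => /(_ _ x0).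
    by apply: filterS => n; rewrite /= sub0r normrN ger0_norm// invr_ge0.
  near: n; exists (Num.truncn x).+1 => // n /= xn.
  have xt : x < (Num.truncn x).+1%:R by rewrite -truncn_lt_nat ?ltW.
  apply: ltW; apply: (lt_le_trans xt); rewrite ler_nat.
  by apply: (leq_trans xn); exact: leqW.
apply/integrableP; split; first by apply/measurable_EFinP; exact: measurable_bump.
under eq_integral do rewrite /= ger0_norm ?bump_ge0//.
rewrite -EU.
have mE n : measurable (E n) by exact: measurable_itv.
have mf n : measurable_fun (E n) (EFin \o bump b).
  have m0 : measurable_fun (`]0%R, +oo[ : set R) (EFin \o bump b).
    by apply/measurable_EFinP; exact: measurable_bump.
  apply: measurable_funS m0; first exact: measurable_itv.
  by rewrite -EU; exact: bigcup_sup.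
have nE : nondecreasing_seq E.
  apply/nondecreasing_seqP => n; rewrite subsetEset => x; rewrite /E /= !in_itv/=.
  move=> /andP[h1 h2]; apply/andP; split.
    by apply: le_trans h1; rewrite lef_pV2 ?posrE// ler_nat.
  by apply: (le_trans h2); rewrite ler_nat.
have f0 n x : E n x -> (0 <= (EFin \o bump b) x)%E by rewrite /= lee_fin bump_ge0.
have h := @ge0_nondecreasing_set_cvg_integral _ _ _ _ _ leb nE mE mf f0.
rewrite -(cvg_lim _ h)//; apply: (@le_lt_trans _ _ (b^-1)%:E); last by rewrite ltry.
apply: lime_le; first exact: cvgP h.
apply: nearW => n; apply: integral_bump_itv_le => //.
by apply: (@le_lt_trans _ _ 1); [rewrite invf_le1// ler1n | rewrite ltr1n].
Unshelve. all: by end_near. Qed.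

End Majorants.

Lemma integrable_mulr {R : realType} (D : set R) (f : R -> R) (c : R) : measurable D ->
  (@lebesgue_measure R).-integrable D (EFin \o f) ->
  (@lebesgue_measure R).-integrable D (EFin \o fun x => f x * c).
Proof.
move=> mD hf.
have : (@lebesgue_measure R).-integrable D (fun x => (f x)%:E * c%:E)%E by exact: integrableZr.
by apply: eq_integrable.
Qed.

(** The absolute value gives a function continuous on the whole line. At 0 continuity is checked by
    hand, as the derivative of the power is available only on z > 0. *)
Lemma continuous_norm_powR {R : realType} (q : R) : 0 < q ->
  continuous (fun z : R => `|z| `^ q).
Proof.
move=> q0 z; have [->|z0] := eqVneq z 0; last first.
  apply: (@continuous_comp _ _ _ (fun z : R => `|z|) (@powR R ^~ q)).
    exact: norm_continuous.
  by apply: continuous_powR; rewrite normr_gt0.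
apply/cvgrPdist_le => /= e e0; have eq0 : 0 < e `^ q^-1 by rewrite powR_gt0.
near=> w; rewrite normr0 powR0 ?gt_eqF// sub0r normrN ger0_norm ?powR_ge0//.
have we : `|w| <= e `^ q^-1.
  near: w; have := @cvg_id R (nbhs (0 : R)); move/cvgrPdist_le => /(_ _ eq0).
  by apply: filterS => w; rewrite /= sub0r normrN.
have -> : e = (e `^ q^-1) `^ q by rewrite -powRrM mulVf ?gt_eqF// powRr1// ltW.
by apply: ge0_ler_powR; rewrite ?nnegrE ?powR_ge0// ltW.
Unshelve. all: by end_near. Qed.

(** * Integral operators on weighted spaces *)

Section RealOperator.
Context {R : realType} (p nu q : R) (ker : R -> R -> R) (W : R -> R).
Notation leb := (@lebesgue_measure R).
Notation D := (`]0%R, +oo[%classic : set R).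
Context (p1 : 1 < p) (p2 : p <= 2) (qE : q = p / (p - 1)).
Context (mker : forall t, measurable_fun D (ker t)).
Context (kerW : forall t x, 0 < x ->
  (`|ker t x| * (1 + `|t|)) `^ q * x `^ ((1 - nu) * q - 1) <= W x).
Context (iW : leb.-integrable D (EFin \o W)).
Context (cker : forall t x, t != 0 -> 0 < x -> {for t, continuous (ker ^~ x)}).

Definition weighted (f : R -> R) (x : R) : R := x `^ (nu * p - 1) * `|f x| `^ p.

(** [K] bounds the p-th power of the norm, which is what Young's inequality consumes. *)
Definition in_ball (K : R) (f : R -> R) : Prop :=
  measurable_fun D f /\ (\int[leb]_(x in D) (weighted f x)%:E <= K%:E)%E.

Definition opR (f : R -> R) (t : R) : R := (\int[leb]_(x in D) (ker t x * f x))%R.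

Lemma q_ge2 : 2 <= q.
Proof. by rewrite qE ler_pdivlMr ?subr_gt0//; move: p2; lra. Qed.

Lemma conjugate_pq : p^-1 + q^-1 = 1.
Proof. by rewrite qE; field; rewrite subr_eq0 !gt_eqF// (lt_trans ltr01). Qed.

Let p0 : 0 < p. Proof. exact: lt_trans p1. Qed.
Let q0 : 0 < q. Proof. by apply: lt_le_trans q_ge2. Qed.

Lemma weighted_ge0 f x : 0 <= weighted f x.
Proof. by rewrite mulr_ge0 ?powR_ge0. Qed.

(* Young's inequality; the scale l is what makes the second term small in
   opR_equicontinuous. *)
Lemma weighted_young (f : R -> R) (a x l : R) : 0 <= a -> 0 < x -> 0 < l ->
  a * `|f x| <= l `^ q * (a `^ q * x `^ ((1 - nu) * q - 1)) / q +
     l `^ (- p) * weighted f x / p.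
Proof.
move=> a0 x0 l0.
have xn0 : x != 0 by rewrite gt_eqF.
(* The weight is split so that the powers q and p produce the exponents (1 - nu) q - 1 and nu p -
   1. *)
have pp : x `^ (p^-1 - nu) * x `^ (nu - p^-1) = 1.
  rewrite -powRD; first by rewrite addrA subrK subrr powRr0.
  by rewrite xn0 implybT.
have -> : a * `|f x| = (l * a * x `^ (p^-1 - nu)) * (l^-1 * (x `^ (nu - p^-1) * `|f x|)).
  rewrite -[LHS]mul1r -pp; field; exact: lt0r_neq0.
apply: le_trans (conjugate_powR _ _ q0 p0 _) _.
- by rewrite !mulr_ge0 ?powR_ge0// ltW.
- by rewrite !mulr_ge0 ?powR_ge0 ?invr_ge0// ltW.
- by rewrite addrC conjugate_pq.
rewrite !powRM ?mulr_ge0 ?powR_ge0 ?invr_ge0 ?(ltW l0)//.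
rewrite -!powRrM -(powR_inv1 (ltW l0)) -powRrM mulN1r.
have -> : (p^-1 - nu) * q = (1 - nu) * q - 1.
  have -> : p^-1 = 1 - q^-1 by rewrite -conjugate_pq addrK.
  by field; exact: lt0r_neq0.
have -> : (nu - p^-1) * p = nu * p - 1 by field; exact: lt0r_neq0.
by rewrite /weighted; apply: lerD; rewrite !mulrA.
Qed.

Lemma ker_young t f x : 0 < x ->
  `|ker t x * f x| * (1 + `|t|) <= W x / q + weighted f x / p.
Proof.
move=> x0; have t1 : 0 <= 1 + `|t| by rewrite addr_ge0.
rewrite normrM mulrAC.
apply: (le_trans (weighted_young f (mulr_ge0 (normr_ge0 (ker t x)) t1) x0 ltr01)).
by rewrite !powR1 !mul1r lerD2r ler_wpM2r ?invr_ge0 ?(ltW q0)// kerW.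
Qed.

Lemma measurable_weighted f : measurable_fun D f -> measurable_fun D (weighted f).
Proof.
move=> mf; apply: measurable_funM.
  apply: open_continuous_measurable_fun => // x.
  by rewrite inE/= in_itv/= andbT; exact: continuous_powR.
have -> : (fun x => `|f x| `^ p) = (@powR R ^~ p) \o ((@Num.norm _ R) \o f) by [].
apply: measurableT_comp; first exact: measurable_powR.
by apply: measurableT_comp => //; exact: normr_measurable.
Qed.

Lemma integrable_weighted K f : in_ball K f -> leb.-integrable D (EFin \o weighted f).
Proof.
move=> [mf hK]; apply/integrableP; split.
  by apply/measurable_EFinP; exact: measurable_weighted.
under eq_integral do rewrite /= ger0_norm ?weighted_ge0//.
by apply: (le_lt_trans hK); rewrite ltry.
Qed.

Let youngmaj f x := W x / q + weighted f x / p.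

Lemma integrable_youngmaj K f : in_ball K f ->
  leb.-integrable D (EFin \o youngmaj f).
Proof.
move=> hf.
have h1 : leb.-integrable D (fun x => (W x)%:E * (q^-1)%:E)%E by exact: integrableZr.
have h2 : leb.-integrable D (fun x => (weighted f x)%:E * (p^-1)%:E)%E.
  by apply: integrableZr => //; exact: integrable_weighted hf.
have : leb.-integrable D ((fun x => (W x)%:E * (q^-1)%:E) \+
  (fun x => (weighted f x)%:E * (p^-1)%:E))%E by exact: integrableD.
by apply: eq_integrable.
Qed.

Definition op_bound (K : R) : R := (\int[leb]_(x in D) W x)%R / q + K / p.

Lemma Rintegral_weighted_le K f : in_ball K f -> (\int[leb]_(x in D) weighted f x)%R <= K.
Proof.
move=> hf; rewrite -lee_fin /Rintegral fineK; first by case: hf.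
by apply: integrable_fin_num => //; exact: integrable_weighted hf.
Qed.

Lemma Rintegral_youngmaj_le K f : in_ball K f ->
  (\int[leb]_(x in D) youngmaj f x)%R <= op_bound K.
Proof.
move=> hf; rewrite /youngmaj RintegralD//.
- rewrite RintegralZr// RintegralZr//; last exact: integrable_weighted hf.
  by rewrite lerD2l ler_wpM2r ?invr_ge0 ?(ltW p0)// Rintegral_weighted_le.
- exact: integrable_mulr.
- by apply: integrable_mulr => //; exact: integrable_weighted hf.
Qed.

Lemma integrable_ker t K f : in_ball K f ->
  leb.-integrable D (EFin \o fun x => ker t x * f x).
Proof.
move=> hf; apply: le_integrable (integrable_youngmaj hf) => //.
  by apply/measurable_EFinP; apply: measurable_funM; [exact: mker | exact: hf.1].
move=> x /=; rewrite in_itv/= andbT => x0; rewrite lee_fin.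
apply: le_trans (ler_norm _); apply: le_trans (ker_young t f x0).
by rewrite ler_peMr// lerDl.
Qed.

Lemma opR_le t K f : in_ball K f -> `|opR f t| <= op_bound K / (1 + `|t|).
Proof.
move=> hf; have t1 : 0 < 1 + `|t| by rewrite ltr_pwDl.
apply: (le_trans (le_normr_Rintegral _ (integrable_ker t hf))) => //.
rewrite ler_pdivlMr//; apply: le_trans (Rintegral_youngmaj_le hf).
have hn := integrable_norm (integrable_ker t hf).
rewrite -RintegralZr//; apply: le_Rintegral => //.
- exact: integrable_mulr.
- exact: integrable_youngmaj hf.
by move=> x /=; rewrite in_itv/= andbT => x0; exact: ker_young.
Qed.

Let dist_ker s t x := `|ker s x - ker t x| `^ q * x `^ ((1 - nu) * q - 1).

Lemma dist_ker_le s t x : 0 < x -> dist_ker s t x <= 2 `^ q * W x.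
Proof.
move=> x0.
have h r : `|ker r x| `^ q * x `^ ((1 - nu) * q - 1) <= W x.
  apply: le_trans (kerW r x0); rewrite ler_wpM2r ?powR_ge0//.
  apply: ge0_ler_powR; rewrite ?nnegrE ?mulr_ge0 ?addr_ge0 ?(ltW q0)//.
  by rewrite ler_peMr// lerDl.
wlog sr : s t / `|ker t x| <= `|ker s x|.
  by move=> hw; have [/hw//|/ltW/hw] := leP `|ker t x| `|ker s x|; rewrite /dist_ker distrC.
apply: (@le_trans _ _ (2 `^ q * (`|ker s x| `^ q * x `^ ((1 - nu) * q - 1)))).
  rewrite mulrA ler_wpM2r ?powR_ge0// -powRM//.
  apply: ge0_ler_powR; rewrite ?nnegrE ?mulr_ge0 ?(ltW q0)//.
  by apply: (le_trans (ler_normB _ _)); lra.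
by rewrite ler_wpM2l ?powR_ge0.
Qed.

Lemma dist_ker_ge0 s t x : 0 <= dist_ker s t x.
Proof. by rewrite mulr_ge0 ?powR_ge0. Qed.

Lemma integrable_dist_ker s t : leb.-integrable D (EFin \o dist_ker s t).
Proof.
have iW' := integrable_mulr (2 `^ q) (measurable_itv `]0%R, +oo[) iW.
apply: le_integrable iW' => //.
  apply/measurable_EFinP; apply: measurable_funM; last first.
    apply: open_continuous_measurable_fun => // x.
    by rewrite inE/= in_itv/= andbT; exact: continuous_powR.
  have -> : (fun x => `|ker s x - ker t x| `^ q) =
    (@powR R ^~ q) \o ((@Num.norm _ R) \o (ker s \- ker t)) by [].
  apply: measurableT_comp; first exact: measurable_powR.
  apply: measurableT_comp; first exact: normr_measurable.
  by apply: measurable_funB; exact: mker.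
move=> x /=; rewrite in_itv/= andbT => x0; rewrite lee_fin.
rewrite ger0_norm ?dist_ker_ge0//; apply: le_trans (ler_norm _).
by rewrite mulrC; exact: dist_ker_le.
Qed.

Lemma cvg_dist_ker t : t != 0 ->
  (\int[leb]_(x in D) dist_ker s t x)%R @[s --> t] --> (0 : R).
Proof.
move=> t0.
have E0 : (\int[leb]_(x in D) dist_ker t t x)%R = 0.
  rewrite /Rintegral integral0_eq// => x _.
  by rewrite /dist_ker subrr normr0 powR0 ?gt_eqF// mul0r.
have iW' := integrable_mulr (2 `^ q) (measurable_itv `]0%R, +oo[) iW.
(* The interval of radius |t| about t avoids 0, so the kernel is continuous in the order throughout
   it. *)
suff : {in (`]t - `|t|, t + `|t|[%classic : set R),
    continuous (fun s => \int[leb]_(x in D) dist_ker s t x)%R}.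
  have tn : 0 < `|t| by rewrite normr_gt0.
  move=> h; have := h t; rewrite /continuous_at E0; apply.
  by rewrite inE/= in_itv/=; lra.
apply: (@continuity_under_integral R _ _ leb (fun s x => dist_ker s t x)
  D _ (t - `|t|) (t + `|t|) _ _ (fun x => W x * 2 `^ q)) => //.
- by move=> s _; exact: integrable_dist_ker.
- apply: aeW => x /=; rewrite in_itv/= andbT => x0 s.
  rewrite inE/= in_itv/= => /andP[s1 s2].
  have s0 : s != 0.
    apply/eqP => s0; move: s1 s2; rewrite s0.
    by have [tp|tn] := leP 0 t; [rewrite ger0_norm// | rewrite ltr0_norm//]; lra.
  apply: (@continuousM _ _ (fun s => `|ker s x - ker t x| `^ q) (fun=> _) s);
    last exact: cst_continuous.
  apply: (@continuous_comp _ _ _ (fun s => ker s x - ker t x) (fun z => `|z| `^ q)).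
    by apply: continuousB; [exact: cker | exact: cst_continuous].
  exact: continuous_norm_powR.
- move=> s _; apply: aeW => x /=; rewrite in_itv/= andbT => x0.
  by rewrite ger0_norm ?dist_ker_ge0// mulrC; exact: dist_ker_le.
Qed.

Lemma opR_equicontinuous t K e : t != 0 -> 0 < e ->
  \forall s \near t, forall f, in_ball K f -> `|opR f s - opR f t| <= e.
Proof.
move=> t0 e0.
(* This [l] makes the term in f at most e / 2 over the whole ball; only then is s taken close to t,
   depending on [l]. The + 1 keeps [l] positive. *)
pose l := ((`|K| + 1) * 2 / (p * e)) `^ p^-1.
have b0 : 0 < (`|K| + 1) * 2 / (p * e).
  by rewrite divr_gt0 ?mulr_gt0// ltr_wpDl.
have l0 : 0 < l by rewrite powR_gt0.
have lp : l `^ (- p) = p * e / ((`|K| + 1) * 2).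
  rewrite /l -powRrM mulrN mulVf ?gt_eqF// powR_inv1 ?(ltW b0)// invf_div//.
have lq : 0 < l `^ q by rewrite powR_gt0.
have d0 : 0 < e / 2 * q / l `^ q by rewrite !mulr_gt0// invr_gt0.
have := cvg_dist_ker t0; move/cvgrPdist_le => /(_ _ d0); apply: filterS => s hs f hf.
have {}hs : (\int[leb]_(x in D) dist_ker s t x)%R <= e / 2 * q / l `^ q.
  by move: hs; rewrite sub0r normrN; apply: le_trans; exact: ler_norm.
have is' := integrable_ker s hf; have it' := integrable_ker t hf.
rewrite /opR -RintegralB//.
have ib : leb.-integrable D (EFin \o fun x => ker s x * f x - ker t x * f x).
  have : leb.-integrable D ((fun x => (ker s x * f x)%:E) \- (fun x => (ker t x * f x)%:E))%E.
    exact: integrableB.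
  by apply: eq_integrable.
apply: (le_trans (le_normr_Rintegral _ ib)) => //.
have i1 := integrable_mulr (l `^ q / q) (measurable_itv `]0%R, +oo[) (integrable_dist_ker s t).
have i2 := integrable_mulr (l `^ (- p) / p) (measurable_itv `]0%R, +oo[) (integrable_weighted hf).
have i12 : leb.-integrable D (EFin \o fun x => dist_ker s t x * (l `^ q / q) +
    weighted f x * (l `^ (- p) / p)).
  have : leb.-integrable D ((fun x => (dist_ker s t x * (l `^ q / q))%:E) \+
      (fun x => (weighted f x * (l `^ (- p) / p))%:E))%E.
    exact: integrableD.
  by apply: eq_integrable.
apply: (@le_trans _ _ (\int[leb]_(x in D) (dist_ker s t x * (l `^ q / q) +
    weighted f x * (l `^ (- p) / p)))%R).
  apply: le_Rintegral => //; first exact: integrable_norm.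
  move=> x /=; rewrite in_itv/= andbT => x0.
  rewrite -mulrBl normrM; apply: (le_trans (weighted_young f (normr_ge0 _) x0 l0)).
  by rewrite le_eqVlt; apply/orP; left; apply/eqP; rewrite /dist_ker; ring.
rewrite RintegralD// RintegralZr//; last exact: integrable_dist_ker.
rewrite RintegralZr//; last exact: integrable_weighted hf.
have h1 : (\int[leb]_(x in D) dist_ker s t x)%R * (l `^ q / q) <= e / 2.
  rewrite -ler_pdivlMr ?divr_gt0//; apply: (le_trans hs).
  by rewrite le_eqVlt; apply/orP; left; apply/eqP; field; rewrite !gt_eqF.
have h2 : (\int[leb]_(x in D) weighted f x)%R * (l `^ (- p) / p) <= e / 2.
  apply: (@le_trans _ _ (`|K| * (l `^ (- p) / p))).
    rewrite ler_wpM2r ?divr_ge0 ?powR_ge0 ?(ltW p0)//.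
    by apply: (le_trans (Rintegral_weighted_le hf)); exact: ler_norm.
  have K1 : 0 < `|K| + 1 by rewrite ltr_wpDl.
  rewrite lp (_ : _ * _ = `|K| / (`|K| + 1) * (e / 2)); last first.
    by field; rewrite !gt_eqF.
  by rewrite ler_piMl ?divr_ge0 ?(ltW e0)// ler_pdivrMr// mul1r lerDl.
by rewrite [leRHS]splitr; exact: lerD.
Qed.

(** Equicontinuity gives continuity off 0, and {0} is a single point; joint measurability of the
    kernel is thereby avoided. *)
Lemma measurable_opR K f : in_ball K f -> measurable_fun setT (opR f).
Proof.
move=> hf; rewrite -(setvU [set (0 : R)]); apply/measurable_funU => //.
  exact: measurableC.
split; last exact: measurable_fun_set1.
apply: open_continuous_measurable_fun.
  exact/closed_openC/accessible_closed_set1/hausdorff_accessible/Rhausdorff.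
move=> t /set_mem /= t0; apply/cvgrPdist_le => e e0.
have t0' : t != 0 by apply/eqP.
have := opR_equicontinuous K t0' e0; apply: filterS => s /(_ f hf).
by rewrite distrC.
Qed.

End RealOperator.

(** * The index transform *)

Section KernelMajorant.
Context {R : realType}.
Notation leb := (@lebesgue_measure R).
Notation D := (`]0%R, +oo[%classic : set R).

(** With e = (1 - nu) / 2 and b = q e, the weight is x^(2 b - 1). The exponent m = e turns it into
    x^(b - 1) for x <= 1, and m = 3 e into x^(- b - 1) for x >= 1. Both are at most 4 [bump b x],
    since 1 + x^b is at most 2 in the first range and at most 2 x^b in the second. *)
Lemma psi_majorant (nu q : R) : nu < 1 -> 0 < q -> exists2 W : R -> R,
  (forall t x, 0 < x ->
    (`|psi t x| * (1 + `|t|)) `^ q * x `^ ((1 - nu) * q - 1) <= W x) &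
  leb.-integrable D (EFin \o W).
Proof.
move=> nu1 q0; pose e := (1 - nu) / 2; pose b := q * e.
have e0 : 0 < e by rewrite divr_gt0// subr_gt0.
have e30 : 0 < 3 * e by rewrite mulr_gt0.
have b0 : 0 < b by rewrite mulr_gt0.
have [C1 C10 hC1] := @psi_bound R _ e0.
have [C2 C20 hC2] := @psi_bound R _ e30.
pose C := C1 + C2; have C0 : 0 <= C by rewrite addr_ge0.
exists (fun x => bump b x * (4 * C `^ q)) => [t x x0|]; last first.
  by apply: integrable_mulr => //; exact: integrable_bump.
have t1 : 0 < 1 + `|t| by rewrite ltr_pwDl.
have -> : (1 - nu) * q - 1 = b + b - 1 by rewrite /b /e; field.
have xn0 : x != 0 by rewrite gt_eqF.
have powD r s : x `^ (r + s) = x `^ r * x `^ s.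
  by rewrite powRD// xn0 implybT.
have main m : `|psi t x| * (1 + `|t|) <= C * x `^ (- m) ->
    (`|psi t x| * (1 + `|t|)) `^ q * x `^ (b + b - 1) <=
    C `^ q * x `^ (- (m * q) + (b + b - 1)).
  move=> h; rewrite (powD (- (m * q))) mulrA ler_wpM2r ?powR_ge0//.
  have -> : C `^ q * x `^ (- (m * q)) = (C * x `^ (- m)) `^ q.
    by rewrite powRM ?powR_ge0// -powRrM mulNr.
  by apply: ge0_ler_powR; rewrite ?nnegrE ?mulr_ge0 ?powR_ge0 ?(ltW q0) ?(ltW t1).
have y0 : 0 < x `^ b by exact: powR_gt0.
have D0 : 0 < (1 + x `^ b) ^+ 2 by rewrite exprn_gt0// ltr_pwDl ?powR_ge0.
have h1 : `|psi t x| * (1 + `|t|) <= C * x `^ (- e).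
  rewrite -ler_pdivlMr//; apply: (le_trans (hC1 t x x0)).
  by rewrite ler_wpM2r ?invr_ge0 ?(ltW t1)// ler_wpM2r ?powR_ge0// lerDl.
have h2 : `|psi t x| * (1 + `|t|) <= C * x `^ (- (3 * e)).
  rewrite -ler_pdivlMr//; apply: (le_trans (hC2 t x x0)).
  by rewrite ler_wpM2r ?invr_ge0 ?(ltW t1)// ler_wpM2r ?powR_ge0// lerDr.
have P0 : 0 <= x `^ (b - 1) by exact: powR_ge0.
have Cq0 : 0 <= C `^ q by exact: powR_ge0.
have bumpE : bump b x * (4 * C `^ q) = C `^ q * (x `^ (b - 1) * (4 / (1 + x `^ b) ^+ 2)).
  by rewrite /bump; ring.
have [x1|/ltW x1] := leP x 1.
  apply: (le_trans (main _ h1)).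
  have -> : - (e * q) + (b + b - 1) = b - 1 by rewrite /b; ring.
  rewrite bumpE ler_wpM2l// mulrA ler_pdivlMr// ler_wpM2l//.
  have y1 : x `^ b <= 1.
    by rewrite -(powRr0 x); apply: ger_powR; rewrite ?x0 ?x1// ltW.
  by nra.
apply: (le_trans (main _ h2)).
have -> : - (3 * e * q) + (b + b - 1) = - b - 1 by rewrite /b; ring.
have y1 : 1 <= x `^ b by rewrite -(powRr0 x); apply: ler_powR => //; exact: ltW.
have Q0 : 0 <= x `^ (- b - 1) by exact: powR_ge0.
have PQ : x `^ (b - 1) = x `^ (- b - 1) * (x `^ b) ^+ 2.
  by rewrite expr2 -!powD; congr (_ `^ _); ring.
rewrite bumpE ler_wpM2l// PQ mulrA ler_pdivlMr// -mulrA ler_wpM2l//.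
by nra.
Qed.

End KernelMajorant.

(** * Reduction of the complex operator to real functions *)

Section ComplexParts.
Context {R : realType}.
Implicit Types (z : R[i]) (f : R -> R[i]).

Lemma normr_Re_le z : `|complex.Re z| <= Normc.normc z.
Proof.
by case: z => a b /=; rewrite -sqrtr_sqr ler_sqrt ?addr_ge0 ?sqr_ge0// lerDl sqr_ge0.
Qed.

Lemma normr_Im_le z : `|complex.Im z| <= Normc.normc z.
Proof.
by case: z => a b /=; rewrite -sqrtr_sqr ler_sqrt ?addr_ge0 ?sqr_ge0// lerDr sqr_ge0.
Qed.

Lemma normc_le z : Normc.normc z <= `|complex.Re z| + `|complex.Im z|.
Proof.
case: z => a b /=; rewrite -[leRHS]ger0_norm ?addr_ge0// -sqrtr_sqr.
rewrite ler_sqrt ?sqr_ge0// -(real_normK (num_real a)) -(real_normK (num_real b)).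
by rewrite sqrrD lerD2r lerDl mulrn_wge0// mulr_ge0.
Qed.

Lemma normc_ge0 z : 0 <= Normc.normc z.
Proof. by case: z => a b; exact: sqrtr_ge0. Qed.

Lemma measurable_normc (D : set R) f : cmeasurable D f ->
  measurable_fun D (fun x => Normc.normc (f x)).
Proof.
move=> [mr mi].
rewrite (_ : (fun _ => _) = Num.sqrt \o
  (fun x => complex.Re (f x) * complex.Re (f x) + complex.Im (f x) * complex.Im (f x))).
  apply: measurableT_comp.
    by apply: continuous_measurable_fun; exact: sqrt_continuous.
  by apply: measurable_funD; apply: measurable_funM.
by apply/funext => x /=; case: (f x) => a b /=; rewrite !expr2.
Qed.

End ComplexParts.

Section OperatorIndex.
Context {R : realType} (p nu : R).
Notation leb := (@lebesgue_measure R).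
Notation D := (`]0%R, +oo[%classic : set R).
Context (p1 : 1 < p).
Implicit Types (f g : R -> R[i]).

Let p0 : 0 < p. Proof. exact: lt_trans p1. Qed.

Lemma wnorm_ball f (M : R) : cmeasurable D f -> (wnorm nu p f <= M%:E)%E ->
  in_ball p nu (M `^ p) (fun x => complex.Re (f x)) /\
  in_ball p nu (M `^ p) (fun x => complex.Im (f x)).
Proof.
move=> mf hM; set N := fun x => x `^ (nu * p - 1) * Normc.normc (f x) `^ p.
have N0 x : 0 <= N x by rewrite mulr_ge0 ?powR_ge0.
have hN : (\int[leb]_(x in D) (N x)%:E <= (M `^ p)%:E)%E.
  have I0 : (0 <= \int[leb]_(x in D) (N x)%:E)%E.
    by apply: integral_ge0 => x _; rewrite lee_fin.
  have M0 : 0 <= M by rewrite -lee_fin; apply: le_trans hM; exact: poweR_ge0.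
  rewrite -(poweRe1 I0) -(mulVf (lt0r_neq0 p0)) poweRrM.
  have -> : (M `^ p)%:E = (M%:E `^ p)%E by [].
  apply: gt0_ler_poweR => //; first exact: ltW.
    by rewrite in_itv/= poweR_ge0 leey.
  by rewrite in_itv/= lee_fin M0 leey.
have mN : measurable_fun D N.
  apply: measurable_funM.
    apply: open_continuous_measurable_fun => // x.
    by rewrite inE/= in_itv/= andbT; exact: continuous_powR.
  have -> : (fun x => Normc.normc (f x) `^ p) =
    (@powR R ^~ p) \o (fun x => Normc.normc (f x)) by [].
  by apply: measurableT_comp; [exact: measurable_powR | exact: measurable_normc].
have le (h : R -> R) : measurable_fun D h -> (forall x, `|h x| <= Normc.normc (f x)) ->
    in_ball p nu (M `^ p) h.
  move=> mh hh; split; first exact: mh.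
  apply: (le_trans _ hN); apply: ge0_le_integral; first exact: measurable_itv.
  - by move=> x _; rewrite lee_fin weighted_ge0.
  - by apply/measurable_EFinP; exact: measurable_weighted.
  - by apply/measurable_EFinP.
  move=> x _; rewrite lee_fin ler_wpM2l ?powR_ge0//.
  by apply: ge0_ler_powR; rewrite ?nnegrE ?normc_ge0// ltW.
split; apply: le; [exact: mf.1 | by move=> x; exact: normr_Re_le
  | exact: mf.2 | by move=> x; exact: normr_Im_le].
Qed.

Lemma wLp_ball f : wLp nu p f -> exists K,
  in_ball p nu K (fun x => complex.Re (f x)) /\ in_ball p nu K (fun x => complex.Im (f x)).
Proof.
move=> [mf fin]; exists (fine (wnorm nu p f) `^ p); apply: wnorm_ball => //.
by rewrite fineK// ge0_fin_numE// poweR_ge0.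
Qed.

Lemma Psi_mulE f t x : 0 < x -> complex.Re (Psi t x * f x) = psi t x * complex.Re (f x) /\
  complex.Im (Psi t x * f x) = psi t x * complex.Im (f x).
Proof. by move=> x0; rewrite PsiE// complex_ReM complex_ImM
  Re_real Im_real !mul0r subr0 addr0. Qed.

Lemma indexFE f t : indexF f t =
  opR psi (fun x => complex.Re (f x)) t +i* opR psi (fun x => complex.Im (f x)) t.
Proof.
rewrite /indexF /cintegral /opR; congr (_ +i* _); apply: eq_Rintegral => x;
  by rewrite inE/= in_itv/= andbT => x0; have [] := Psi_mulE f t x0.
Qed.

End OperatorIndex.

(** * Compactness in L_q *)

Section Compactness.
Context {R : realType} (p nu q : R) (W : R -> R).
Notation leb := (@lebesgue_measure R).
Notation D := (`]0%R, +oo[%classic : set R).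
Context (p1 : 1 < p) (p2 : p <= 2) (qE : q = p / (p - 1)).
Context (kerW : forall t x, 0 < x ->
  (`|psi t x| * (1 + `|t|)) `^ q * x `^ ((1 - nu) * q - 1) <= W x).
Context (iW : leb.-integrable D (EFin \o W)).
Implicit Types (f g h : R -> R[i]).

Let q2 : 2 <= q. Proof. exact: q_ge2 qE. Qed.
Let q0 : 0 < q. Proof. exact: lt_le_trans q2. Qed.
Let cpsi t x : t != 0 -> 0 < x -> {for t, continuous (psi ^~ x)} :=
  @continuous_psi_order R t x.
Let mpsi := @measurable_psi R.

Notation re f := (fun x : R => complex.Re (f x)).
Notation im f := (fun x : R => complex.Im (f x)).

Lemma cintegrable_indexF f t : wLp nu p f ->
  cintegrable `]0, +oo[ (fun x : R => Psi t x * f x).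
Proof.
move=> /(wLp_ball p1)[K [hr hi]].
have ir := integrable_ker p1 p2 qE mpsi kerW iW t hr.
have ii := integrable_ker p1 p2 qE mpsi kerW iW t hi.
split; [apply: eq_integrable ir | apply: eq_integrable ii] => //= x;
  by rewrite inE/= in_itv/= andbT => x0; have [e1 e2] := Psi_mulE f t x0; rewrite ?e1 ?e2.
Qed.

(** It dominates (B / (1 + |t|))^q because q >= 2, which comes from p <= 2: (1 + |t|)^q >= (1 +
    |t|)^2 >= 1 + t^2. Integrability is then that of the derivative of the arctangent. *)
Definition Lq_majorant (B t : R) : R := B `^ q * (1 + t ^+ 2)^-1.

Lemma powR_le_majorant (B t c : R) : 0 <= B -> 0 <= c -> c <= B / (1 + `|t|) ->
  c `^ q <= Lq_majorant B t.
Proof.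
move=> B0 c0 cB; have t1 : 1 <= 1 + `|t| by rewrite lerDl.
have t0 : 0 < 1 + `|t| by exact: lt_le_trans t1.
apply: (@le_trans _ _ ((B / (1 + `|t|)) `^ q)).
  by apply: ge0_ler_powR; rewrite ?nnegrE ?divr_ge0 ?(ltW q0) ?(ltW t0).
rewrite powRM ?invr_ge0 ?(ltW t0)// ler_wpM2l ?powR_ge0//.
rewrite -(powR_inv1 (ltW t0)) powRAC powR_inv1 ?powR_ge0//.
rewrite lef_pV2 ?posrE ?powR_gt0// ?ltr_pwDl ?sqr_ge0//.
apply: (@le_trans _ _ ((1 + `|t|) `^ 2)); last exact: ler_powR.
rewrite powR_mulrn ?(ltW t0)// sqrrD expr1n mul1r real_normK ?num_real//.
by rewrite lerD2r lerDl mulrn_wge0.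
Qed.

Lemma integrable_majorant B : leb.-integrable setT (EFin \o Lq_majorant B).
Proof.
have := integrable_mulr (B `^ q) measurableT (@integrable_oneDsqrV R).
by apply: eq_integrable => // t _; rewrite /= /Lq_majorant mulrC.
Qed.

Lemma measurable_normc_powR h : cmeasurable setT h ->
  measurable_fun setT (fun t => Normc.normc (h t) `^ q).
Proof.
move=> mh; have -> : (fun t => Normc.normc (h t) `^ q) =
  (@powR R ^~ q) \o (fun t => Normc.normc (h t)) by [].
by apply: measurableT_comp; [exact: measurable_powR | exact: measurable_normc].
Qed.

Lemma LqnormE h : Lqnorm q h =
  ((\int[leb]_t (Normc.normc (h t) `^ q)%:E) `^ q^-1)%E.
Proof.
rewrite /Lqnorm unlock; congr (_ `^ _)%E; apply: eq_integral => t _.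
by rewrite /= ger0_norm ?normc_ge0.
Qed.

Lemma Lq_of_bound h (B : R) : 0 <= B -> cmeasurable setT h ->
  (forall t, Normc.normc (h t) <= B / (1 + `|t|)) -> Lq q h.
Proof.
move=> B0 mh hB; split=> //; rewrite LqnormE; apply: poweR_lty.
have /integrableP[mM iM] := integrable_majorant B.
apply: le_lt_trans iM; apply: ge0_le_integral; first exact: measurableT.
- by move=> t _; rewrite lee_fin powR_ge0.
- by apply/measurable_EFinP; exact: measurable_normc_powR.
- by apply: measurableT_comp.
move=> t _ /=; rewrite lee_fin; apply: le_trans (ler_norm _).
by apply: powR_le_majorant => //; exact: normc_ge0.
Qed.

Lemma indexF_ball_bound K f t : in_ball p nu K (re f) -> in_ball p nu K (im f) ->
  Normc.normc (indexF f t) <= 2 * op_bound p q W K / (1 + `|t|).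
Proof.
move=> hr hi; rewrite indexFE; apply: (le_trans (normc_le _)) => /=.
have h1 := opR_le p1 p2 qE mpsi kerW iW t hr.
have h2 := opR_le p1 p2 qE mpsi kerW iW t hi.
by apply: (le_trans (lerD h1 h2)); rewrite -mulrDl -mulr2n mulr_natl.
Qed.

Lemma op_bound_ball_ge0 K (h : R -> R) : in_ball p nu K h -> 0 <= op_bound p q W K.
Proof.
move=> hh; have := opR_le p1 p2 qE mpsi kerW iW 0 hh.
by rewrite normr0 addr0 divr1; apply: le_trans.
Qed.

Lemma cmeasurable_indexF K f : in_ball p nu K (re f) -> in_ball p nu K (im f) ->
  cmeasurable setT (indexF f).
Proof.
move=> hr hi; split.
  rewrite (_ : (fun _ => _) = opR psi (re f)).
    exact: (measurable_opR p1 p2 qE mpsi kerW iW cpsi hr).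
  by apply/funext => t; rewrite indexFE.
rewrite (_ : (fun _ => _) = opR psi (im f)).
  exact: (measurable_opR p1 p2 qE mpsi kerW iW cpsi hi).
by apply/funext => t; rewrite indexFE.
Qed.

Lemma indexF_Lq f : wLp nu p f -> Lq q (indexF f).
Proof.
move=> /(wLp_ball p1)[K [hr hi]].
apply: (@Lq_of_bound _ (2 * op_bound p q W K)).
- by rewrite mulr_ge0// (op_bound_ball_ge0 hr).
- exact: cmeasurable_indexF hr hi.
by move=> t; exact: indexF_ball_bound.
Qed.

Lemma opR_lincomb (f1 f2 f3 : R -> R) (K1 K2 K3 c1 c2 t : R) :
  in_ball p nu K1 f1 -> in_ball p nu K2 f2 -> in_ball p nu K3 f3 ->
  opR psi (fun x => c1 * f1 x + c2 * f2 x + f3 x) t =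
  c1 * opR psi f1 t + c2 * opR psi f2 t + opR psi f3 t.
Proof.
move=> h1 h2 h3.
have i1 := integrable_ker p1 p2 qE mpsi kerW iW t h1.
have i2 := integrable_ker p1 p2 qE mpsi kerW iW t h2.
have i3 := integrable_ker p1 p2 qE mpsi kerW iW t h3.
have mD : measurable D by exact: measurable_itv.
have j1 := integrable_mulr c1 mD i1; have j2 := integrable_mulr c2 mD i2.
have j12 : leb.-integrable D (EFin \o fun x => psi t x * f1 x * c1 + psi t x * f2 x * c2).
  have : leb.-integrable D ((fun x => (psi t x * f1 x * c1)%:E) \+
      (fun x => (psi t x * f2 x * c2)%:E))%E by exact: integrableD.
  by apply: eq_integrable.
rewrite /opR ![_ * Rintegral _ _ _]mulrC -!RintegralZr// -RintegralD// -RintegralD//.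
by apply: eq_Rintegral => x _; ring.
Qed.

Lemma indexF_linear (a : R[i]) f g t : wLp nu p f -> wLp nu p g ->
  indexF (fun x => a * f x + g x) t = a * indexF f t + indexF g t.
Proof.
move=> /(wLp_ball p1)[K [fr fi]] /(wLp_ball p1)[K' [gr gi]].
rewrite !indexFE; case: a => a b.
have -> : (re (fun x => (a +i* b) * f x + g x)) =
    fun x => a * complex.Re (f x) + (- b) * complex.Im (f x) + complex.Re (g x).
  by apply/funext => x; case: (f x) => c d; case: (g x) => c' d' /=; ring.
have -> : (im (fun x => (a +i* b) * f x + g x)) =
    fun x => b * complex.Re (f x) + a * complex.Im (f x) + complex.Im (g x).
  by apply/funext => x; case: (f x) => c d; case: (g x) => c' d' /=; ring.
rewrite (opR_lincomb _ _ _ fr fi gr) (opR_lincomb _ _ _ fr fi gi).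
by apply/eqP; rewrite eq_complex /=; apply/andP; split; apply/eqP; ring.
Qed.

(** Dominated convergence for the q-th powers, followed by continuity of the q-th root at 0. *)
Lemma Lqnorm_cvg0 (h_ : nat -> R -> R[i]) (B : R) : 0 <= B ->
  (forall n, cmeasurable setT (h_ n)) ->
  (forall n t, Normc.normc (h_ n t) <= B / (1 + `|t|)) ->
  (forall t, Normc.normc (h_ n t) @[n --> \oo] --> (0 : R)) ->
  (fun n => Lqnorm q (h_ n)) @ \oo --> 0%E.
Proof.
move=> B0 mh hB h0.
pose u n t := (Normc.normc (h_ n t) `^ q)%:E.
have [] := @dominated_convergence _ _ _ leb setT measurableT u (cst 0%E)
  (EFin \o Lq_majorant B).
- by move=> n; apply/measurable_EFinP; exact: measurable_normc_powR.
- exact: measurable_cst.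
- apply: aeW => t _; apply: cvg_EFin; first exact: nearW.
  rewrite (_ : fine \o u ^~ t = fun n => `|Normc.normc (h_ n t)| `^ q); last first.
    by apply/funext => n; rewrite /u /= ger0_norm ?normc_ge0.
  have -> : (0 : R) = `|0 : R| `^ q by rewrite normr0 powR0 ?gt_eqF.
  apply: (@continuous_cvg _ _ _ _ _ _ (fun z : R => `|z| `^ q)) => //.
  exact: continuous_norm_powR.
- exact: integrable_majorant.
- apply: aeW => t n _; rewrite /u /= lee_fin ger0_norm ?powR_ge0//.
  by apply: powR_le_majorant => //; exact: normc_ge0.
move=> _ _; rewrite integral0_eq// => hu.
(* Finiteness allows the root to be taken in [R], where its continuity is known. *)
have uf n : (\int[leb]_t u n t)%E \is a fin_num.
  rewrite ge0_fin_numE; last by apply: integral_ge0 => t _; rewrite lee_fin powR_ge0.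
  have [_] : Lq q (h_ n) by exact: (Lq_of_bound B0).
  rewrite LqnormE; apply: lty_poweRy; first by rewrite invr_neq0// gt_eqF.
rewrite (_ : (fun n => _) = fun n => ((fine (\int[leb]_t u n t)%E) `^ q^-1)%:E); last first.
  by apply/funext => n; rewrite LqnormE -poweR_EFin fineK.
apply: cvg_EFin; first exact: nearW.
have {}hu := fine_cvg hu.
have -> : (0 : R) = `|0 : R| `^ q^-1 by rewrite normr0 powR0 ?invr_neq0 ?gt_eqF.
rewrite (_ : fine \o _ = fun n => `|fine (\int[leb]_t u n t)%E| `^ q^-1); last first.
  apply/funext => n; rewrite /= ger0_norm// fine_ge0//.
  by apply: integral_ge0 => t _; rewrite lee_fin powR_ge0.
apply: (@continuous_cvg _ _ _ _ _ _ (fun z : R => `|z| `^ q^-1)) => //.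
  by apply: continuous_norm_powR; rewrite invr_gt0.
exact: hu.
Qed.

(** The boolean selects the real or the imaginary part: one family indexed by [bool * R] lets a
    single extraction serve both. Indices that encode nothing are sent to (true, 0). *)
Definition sample (j : nat) : bool * R :=
  let: (b, r) := odflt (true, 0%:Q) (unpickle j) in (b, ratr r).

Lemma sampleE (b : bool) (r : rat) : sample (pickle (b, r)) = (b, ratr r).
Proof. by rewrite /sample pickleK. Qed.

Lemma rat_near (t : R) (A : set R) : nbhs t A -> exists r : rat, A (ratr r).
Proof.
move=> /nbhs_ballP[e /= e0 eA].
have /rat_in_itvoo[r] : t < t + e by rewrite ltrDl.
rewrite in_itv/= => /andP[r1 r2]; exists r; apply: eA; rewrite /ball /=.
by rewrite ltr_norml; lra.
Qed.

Lemma sequentially_compact_indexF (f_ : nat -> R -> R[i]) (K : R) :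
  (forall n, in_ball p nu K (re (f_ n))) -> (forall n, in_ball p nu K (im (f_ n))) ->
  exists (phi : nat -> nat) (g : R -> R[i]),
    [/\ {homo phi : m n / (m < n)%N}, Lq q g &
        (fun n => Lqnorm q (fun t => indexF (f_ (phi n)) t - g t)) @ \oo --> 0%E].
Proof.
move=> hr hi.
pose w n (bt : bool * R) :=
  if bt.1 then opR psi (re (f_ n)) bt.2 else opR psi (im (f_ n)) bt.2.
set B := op_bound p q W K.
have B0 : 0 <= B by exact: op_bound_ball_ge0 (hr 0%N).
have wB n bt : `|w n bt| <= B / (1 + `|bt.2|).
  rewrite /w; case: ifP => _.
    exact: (opR_le p1 p2 qE mpsi kerW iW bt.2 (hr n)).
  exact: (opR_le p1 p2 qE mpsi kerW iW bt.2 (hi n)).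
have wd bt e : 0 < e -> exists j, forall n, `|w n (sample j) - w n bt| <= e.
  case: bt => b t e0.
  have [->|t0] := eqVneq t 0.
    exists (pickle (b, 0%:Q)) => n; rewrite sampleE rmorph0 subrr normr0; exact: ltW.
  have [r hrat] := rat_near (opR_equicontinuous p1 p2 qE mpsi kerW iW cpsi K t0 e0).
  exists (pickle (b, r)) => n; rewrite sampleE /w /=.
  by case: b; exact: hrat.
have [phi [L [phi_incr hL]]] := pointwise_extraction wB wd.
have LB bt : `|L bt| <= B / (1 + `|bt.2|).
  have h : `|w (phi n) bt| @[n --> \oo] --> `|L bt| by apply: cvg_norm; exact: hL.
  rewrite -(cvg_lim _ h)//; apply: limr_le; first by apply/cvg_ex; exists `|L bt|.
  by apply: nearW => n; exact: wB.
pose g t := L (true, t) +i* L (false, t).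
have mg : cmeasurable setT g.
  split=> /=.
    apply: (measurable_fun_cvg (h := fun n t => w (phi n) (true, t))) => [n|t _].
      exact: (measurable_opR p1 p2 qE mpsi kerW iW cpsi (hr (phi n))).
    exact: hL.
  apply: (measurable_fun_cvg (h := fun n t => w (phi n) (false, t))) => [n|t _].
    exact: (measurable_opR p1 p2 qE mpsi kerW iW cpsi (hi (phi n))).
  exact: hL.
have parts n t : indexF (f_ (phi n)) t - g t =
    (w (phi n) (true, t) - L (true, t)) +i* (w (phi n) (false, t) - L (false, t)).
  by rewrite indexFE.
exists phi, g; split => //.
  apply: (@Lq_of_bound _ (2 * B)) => //; first by rewrite mulr_ge0.
  move=> t; apply: (le_trans (normc_le _)) => /=.
  have h1 := LB (true, t); have h2 := LB (false, t).
  by apply: (le_trans (lerD h1 h2)); rewrite -mulrDl -mulr2n mulr_natl.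
(* Four real terms, the two parts of the image and the two of the limit, are each at most B / (1 +
   |t|). *)
apply: (@Lqnorm_cvg0 _ (4 * B)); first by rewrite mulr_ge0.
- move=> n; have [m1 m2] := cmeasurable_indexF (hr (phi n)) (hi (phi n)).
  have partsB (y z : R[i]) : complex.Re (y - z) = complex.Re y - complex.Re z /\
      complex.Im (y - z) = complex.Im y - complex.Im z by case: y; case: z.
  case: mg => g1 g2; split.
    rewrite (_ : (fun _ => _) = re (indexF (f_ (phi n))) \- re g).
      exact: measurable_funB.
    by apply/funext => t; have [-> _] := partsB (indexF (f_ (phi n)) t) (g t).
  rewrite (_ : (fun _ => _) = im (indexF (f_ (phi n))) \- im g).
    exact: measurable_funB.
  by apply/funext => t; have [_ ->] := partsB (indexF (f_ (phi n)) t) (g t).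
- move=> n t; rewrite parts; apply: (le_trans (normc_le _)) => /=.
  have h1 := LB (true, t); have h2 := LB (false, t).
  have h3 := wB (phi n) (true, t); have h4 := wB (phi n) (false, t).
  rewrite /= in h1 h2 h3 h4.
  apply: (le_trans (lerD (ler_normB _ _) (ler_normB _ _))).
  have -> : 4 * B / (1 + `|t|) = B / (1 + `|t|) + B / (1 + `|t|) +
     (B / (1 + `|t|) + B / (1 + `|t|)) by ring.
  by rewrite !lerD.
move=> t.
have lim0 b : `|w (phi n) (b, t) - L (b, t)| @[n --> \oo] --> (0 : R).
  rewrite -(normr0 R) -(subrr (L (b, t))); apply: cvg_norm.
  by apply: cvgB; [exact: hL | exact: cvg_cst].
have lim00 : `|w (phi n) (true, t) - L (true, t)| + `|w (phi n) (false, t) - L (false, t)|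
    @[n --> \oo] --> (0 : R).
  by rewrite -(addr0 (0 : R)); apply: cvgD; exact: lim0.
apply: (squeeze_cvgr _ (cvg_cst 0) lim00); apply: nearW => n.
by rewrite normc_ge0 parts; exact: normc_le.
Qed.


End Compactness.

(* The first conjunct says that the integral defining F f converges absolutely
   for every tau <> 0, so that the operator is well defined. *)
Theorem theorem2 (R : realType) (p nu q : R)
    (hp1 : 1 < p) (hp2 : p <= 2) (hnu : nu < 1) (hq : q = p / (p - 1)) :
  (forall f : R -> R[i], wLp nu p f -> forall tau : R, tau != 0 ->
     cintegrable `]0, +oo[ (fun x : R => Psi tau x * f x)) /\
  compact_operator (wLp nu p) (wnorm nu p) (Lq q) (Lqnorm q) (@indexF R).
Proof.
have q2 := q_ge2 hp1 hp2 hq.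
have q0 : 0 < q by exact: lt_le_trans q2.
have [W kerW iW] := psi_majorant hnu q0.
split=> [f hf tau _|]; first exact: (cintegrable_indexF hp1 hp2 hq kerW iW).
split.
- by move=> f hf; exact: (indexF_Lq hp1 hp2 hq kerW iW).
(* Linearity holds at every t, so the difference is identically 0 and not merely almost
   everywhere. *)
- move=> a f g hf hg; rewrite /Lqnorm (_ : (fun t => _) = cst 0%E).
    by rewrite Lnorm0// eqe gt_eqF.
  apply/funext => t; rewrite (indexF_linear hp1 hp2 hq kerW iW)// subrr.
  by rewrite Normc.normc0.
move=> f_ Xf [M hM].
have hK n := wnorm_ball hp1 (proj1 (Xf n)) (hM n).
exact: (sequentially_compact_indexF hp1 hp2 hq kerW iW
  (fun n => proj1 (hK n)) (fun n => proj2 (hK n))).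
Qed.
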